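(* Let $n\ge 2$, $Q=n+2$ (so $Q\ge4$) and $0<R\leq\infty$. Let $W$ be any real-valued function on $(0,R)$ for which the integrals below are well defined. Then $$\int_{B_{R}(o)} |\nabla_G u|^{2} \,dx\,dt \geq \int_{B_{R}(o)} W(\varrho)|u|^{2}|\nabla_G \varrho|^2\,dx\,dt \quad \text{ for all } u\in C_{c}^{\infty}(B_{R}(o) \setminus\{o\})$$ if and only if $$\int_{B_{R}(o)} |\nabla_G u|^{2} \,dx\,dt \geq \int_{B_{R}(o)} W(\varrho)|u|^{2}|\nabla_G \varrho|^2\,dx\,dt \quad \text{ for all } u\in C_{c,rad}^{\infty}(B_{R}(o) \setminus\{o\}).$$
   Context: Grushin space: fix an integer $n\ge 2$ and put $Q=n+2$ (homogeneous dimension). Points of $\mathbb{R}^{n+1}$ are written $(x,t)$ with $x\in\mathbb{R}^n$, $t\in\mathbb{R}$; $o$ is the origin; all functions are real-valued. The Grushin gradient is $\nabla_G u=(\nabla_x u,\ |x|\partial_t u)$, so $|\nabla_G u|^2=|\nabla_x u|^2+|x|^2(\partial_t u)^2$. The homogeneous norm is $\varrho(x,t)=(|x|^4+4t^2)^{1/4}$; it satisfies $|\nabla_G\varrho|^2=|x|^2/\varrho^2$ away from $o$. For $0<R\le\infty$, $B_R(o)=\{(x,t):\varrho(x,t)<R\}$ (so $B_\infty(o)=\mathbb{R}^{n+1}$). $C^\infty_{c,rad}(B_R(o)\setminus\{o\})$ is the set of functions in $C^\infty_c(B_R(o)\setminus\{o\})$ that are radial, i.e. depend only on $\varrho(x,t)$.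 *)

(* Defs.v *)
From HB Require Import structures.
From mathcomp Require Import all_boot all_order all_algebra.
From mathcomp Require Import all_classical all_reals all_analysis.
From mathcomp Require Import measurable_realfun.

Set Implicit Arguments.
Unset Strict Implicit.
Unset Printing Implicit Defensive.

Import Order.TTheory GRing.Theory Num.Theory.
Import numFieldNormedType.Exports.

Local Open Scope classical_set_scope.
Local Open Scope ring_scope.

(* The Borel sigma-algebra of R^n, presented as generated by the coordinates,
   as the library does for n.-tuple R. *)
Section rV_measurable.
Context (R : realType) (n : nat).

Definition rV_coord (i : 'I_n) (x : 'rV[R]_n) : measurableTypeR R := x ord0 i.

Let rV_set0 : g_sigma_preimage rV_coord set0.
Proof. exact: sigma_algebra0. Qed.

Let rV_setC A : g_sigma_preimage rV_coord A -> g_sigma_preimage rV_coord (~` A).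
Proof. exact: sigma_algebraC. Qed.

Let rV_bigcup (F : (set 'rV[R]_n)^nat) :
  (forall i, g_sigma_preimage rV_coord (F i)) ->
  g_sigma_preimage rV_coord (\bigcup_i (F i)).
Proof. exact: sigma_algebra_bigcup. Qed.

HB.instance Definition _ := @isMeasurable.Build
  (measure_tuple_display default_measure_display)
  'rV[R]_n (g_sigma_preimage rV_coord) rV_set0 rV_setC rV_bigcup.

Lemma measurable_rV_coord i : measurable_fun [set: 'rV[R]_n] (rV_coord i).
Proof.
move=> _ Y mY; rewrite setTI; apply: sub_sigma_algebra => /=.
rewrite -bigcup_seq/=; exists i => /=; first by rewrite mem_index_enum.
by exists Y => //; rewrite setTI.
Qed.

Lemma measurable_fun_rV d (T : measurableType d) (f : T -> 'rV[R]_n) :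
  (forall i, measurable_fun [set: T] (rV_coord i \o f)) ->
  measurable_fun [set: T] f.
Proof.
move=> mf; have sub : g_sigma_preimage (fun i => rV_coord i \o f) `<=` measurable.
  apply: smallest_sub; first exact: sigma_algebra_measurable.
  rewrite -bigcup_seq => A [i _ [B mB <-]].
  exact: mf.
rewrite g_sigma_preimage_comp in sub.
by move=> _ A mA; apply: sub; exists A.
Qed.

End rV_measurable.

Section rV_cons.
Context (R : realType) (n : nat).

Definition rV_cons (p : measurableTypeR R * 'rV[R]_n) : 'rV[R]_n.+1 :=
  \row_i oapp (fun j => p.2 ord0 j) p.1 (unlift ord0 i).

Definition rV_uncons (x : 'rV[R]_n.+1) : measurableTypeR R * 'rV[R]_n :=
  (x ord0 ord0, \row_j x ord0 (lift ord0 j)).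

Lemma rV_consK : cancel rV_cons rV_uncons.
Proof.
move=> [a x]; rewrite /rV_uncons !mxE unlift_none /=; congr pair.
by apply/rowP => j; rewrite !mxE liftK.
Qed.

Lemma measurable_rV_cons : measurable_fun setT rV_cons.
Proof.
apply: measurable_fun_rV => i.
have [j ->|->] := unliftP ord0 i.
  rewrite (_ : _ \o _ = rV_coord j \o snd); last first.
    by apply/funext => p; rewrite /= /rV_coord mxE liftK.
  by apply: measurableT_comp; [exact: measurable_rV_coord|exact: measurable_snd].
rewrite (_ : _ \o _ = fst); first exact: measurable_fst.
by apply/funext => p; rewrite /= /rV_coord mxE unlift_none.
Qed.

Lemma measurable_rV_uncons : measurable_fun setT rV_uncons.
Proof.
apply/measurable_fun_pairP; split; first exact: (@measurable_rV_coord R n.+1 ord0).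
apply: measurable_fun_rV => i.
rewrite (_ : _ \o _ = rV_coord (lift ord0 i)); first exact: measurable_rV_coord.
by apply/funext => p; rewrite /= /rV_coord mxE.
Qed.

End rV_cons.

Lemma product_sigma_finite d1 d2 (T1 : measurableType d1)
    (T2 : measurableType d2) (R : realType)
    (m1 : {sigma_finite_measure set T1 -> \bar R})
    (m2 : {sigma_finite_measure set T2 -> \bar R}) :
  sigma_finite setT (m1 \x m2)%E.
Proof.
have /sigma_finiteP[F [TF ndF Foo]] := sigma_finiteT m1.
have /sigma_finiteP[G [TG ndG Goo]] := sigma_finiteT m2.
exists (fun k => F k `*` G k).
  rewrite -setXTT TF TG predeqE => -[x y]; split; last first.
    by move=> [k _ []/= ? ?]; split; exists k.
  move=> [/= [k _ Fkx] [l _ Gly]]; exists (maxn k l) => //; split.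
    by move: x Fkx; exact/subsetPset/ndF/leq_maxl.
  by move: y Gly; exact/subsetPset/ndG/leq_maxr.
move=> k; have [? ?] := Foo k; have [? ?] := Goo k.
split; first exact: measurableX.
by rewrite product_measure1E// lte_mul_pinfty// ge0_fin_numE.
Qed.

Section rV_lebesgue_step.
Local Open Scope ereal_scope.
Context (R : realType) (n : nat).
Variable mu : {sigma_finite_measure set 'rV[R]_n -> \bar R}.

Definition rV_lebesgue_step : set 'rV[R]_n.+1 -> \bar R :=
  pushforward (lebesgue_measure \x mu) (@rV_cons R n).

Let step0 : rV_lebesgue_step set0 = 0.
Proof. by rewrite /rV_lebesgue_step /pushforward preimage_set0 measure0. Qed.

Let step_ge0 A : 0 <= rV_lebesgue_step A.
Proof. exact: (@measure_ge0 _ _ _ (lebesgue_measure \x mu)%E). Qed.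

Let step_sigma_additive : semi_sigma_additive rV_lebesgue_step.
Proof.
move=> F mF tF mUF; rewrite /rV_lebesgue_step /pushforward preimage_bigcup.
have mC (A : set 'rV[R]_n.+1) : measurable A -> measurable (@rV_cons R n @^-1` A).
  by move=> mA; rewrite -[X in measurable X]setTI; exact: measurable_rV_cons.
apply: measure_semi_sigma_additive.
- by move=> k; exact: mC.
- apply/trivIsetP => /= i j _ _ ij; rewrite -preimage_setI.
  by move/trivIsetP : tF => /(_ _ _ _ _ ij) ->//; rewrite preimage_set0.
- by rewrite -preimage_bigcup; exact: mC.
Qed.

HB.instance Definition _ := isMeasure.Build _ _ _
  rV_lebesgue_step step0 step_ge0 step_sigma_additive.

Let step_sigma_finite : sigma_finite setT rV_lebesgue_step.
Proof.
have [F FT Foo] : sigma_finite setT (lebesgue_measure \x mu).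
  exact: product_sigma_finite.
exists (fun k => @rV_uncons R n @^-1` F k).
  by rewrite -preimage_bigcup -FT preimage_setT.
move=> k; have [mFk Fkoo] := Foo k; split.
  by rewrite -[X in measurable X]setTI; exact: measurable_rV_uncons.
rewrite /rV_lebesgue_step /pushforward (_ : _ @^-1` _ = F k)//.
by apply/seteqP; split=> p; rewrite /preimage/= rV_consK.
Qed.

HB.instance Definition _ :=
  Measure_isSigmaFinite.Build _ _ _ rV_lebesgue_step step_sigma_finite.

End rV_lebesgue_step.

(* n-dimensional Lebesgue measure: a point mass on R^0, and the product of
   1-dimensional and n-dimensional Lebesgue measure on R^(n+1). *)
Fixpoint rV_lebesgue (R : realType) (n : nat) :
    {sigma_finite_measure set 'rV[R]_n -> \bar R} :=
  match n with
  | 0%N => dirac (0 : 'rV[R]_0)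
  | m.+1 => rV_lebesgue_step (rV_lebesgue R m)
  end.

Section smooth.
Context (R : realType) (V : normedModType R).

(* In finite dimension, u is C^(k+1) iff it is differentiable everywhere and
   all its directional derivatives are C^k. *)
Fixpoint Ck (k : nat) (u : V -> R) : Prop :=
  match k with
  | 0%N => continuous u
  | j.+1 => (forall z, differentiable u z) /\ (forall v, Ck j ('D_v u))
  end.

Definition smooth (u : V -> R) : Prop := forall k, Ck k u.

(* C^infty_c(U), each function being extended by 0 outside U. *)
Definition test_function (U : set V) (u : V -> R) : Prop :=
  [/\ smooth u, compact (closure [set z | u z != 0])
    & closure [set z | u z != 0] `<=` U].

End smooth.

(* The integral of f over D makes sense in [-oo, +oo]: f is Lebesgue
   measurable on D, i.e. almost everywhere equal to a Borel function, whose
   positive and negative parts do not both have an infinite integral. *)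
Definition integral_defined d (T : measurableType d) (R : realType)
    (mu : {measure set T -> \bar R}) (D : set T) (f : T -> \bar R) : Prop :=
  exists g : T -> \bar R,
    [/\ measurable_fun D g, ae_eq mu D f g
      & (\int[mu]_(x in D) g^\+ x < +oo \/ \int[mu]_(x in D) g^\- x < +oo)%E].

Section grushin.
Context (R : realType) (n : nat).
Implicit Types (z : 'rV[R]_n * R) (u : 'rV[R]_n * R -> R).

(* The Euclidean norm on R^n; the norm of the library is the sup norm. *)
Definition enorm (x : 'rV[R]_n) : R := Num.sqrt (\sum_(i < n) x ord0 i ^+ 2).

Definition grushin_norm z : R := (enorm z.1 ^+ 4 + 4 * z.2 ^+ 2) `^ (4^-1).

Definition basis_x (i : 'I_n) : 'rV[R]_n * R := (delta_mx ord0 i, 0).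

Definition basis_t : 'rV[R]_n * R := (0, 1).

Definition grad_x u z : 'rV[R]_n := \row_i 'D_(basis_x i) u z.

Definition d_t u z : R := 'D_basis_t u z.

Definition grushin_grad u z : 'rV[R]_n * R :=
  (grad_x u z, enorm z.1 * d_t u z).

Definition sqnorm (w : 'rV[R]_n * R) : R := enorm w.1 ^+ 2 + w.2 ^+ 2.

Definition grushin_ball (r : \bar R) : set ('rV[R]_n * R)%type :=
  [set z | ((grushin_norm z)%:E < r)%E].

Definition radial u : Prop :=
  exists f : R -> R, forall z, u z = f (grushin_norm z).

Definition grushin_volume :
    {measure set ('rV[R]_n * measurableTypeR R)%type -> \bar R} :=
  (rV_lebesgue R n \x lebesgue_measure)%E.

Definition energy (r : \bar R) u : \bar R :=
  (\int[grushin_volume]_(z in grushin_ball r) (sqnorm (grushin_grad u z))%:E)%E.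

(* W only matters on ]0, r[, and the values at the origin of W \o grushin_norm
   and of the derivatives of grushin_norm (which is not differentiable there)
   are irrelevant: test functions on grushin_ball r `\ 0 vanish there. *)
Definition potential_density (W : R -> R) u z : R :=
  W (grushin_norm z) * `|u z| ^+ 2 * sqnorm (grushin_grad grushin_norm z).

Definition potential_energy (r : \bar R) (W : R -> R) u : \bar R :=
  (\int[grushin_volume]_(z in grushin_ball r) (potential_density W u z)%:E)%E.

End grushin.

(* Main.v *)
Require Import Defs.
From HB Require Import structures.
From mathcomp Require Import all_boot all_order all_algebra.
From mathcomp Require Import all_classical all_reals all_analysis.
From mathcomp Require Import measurable_realfun.
From mathcomp Require Import ring lra.

Set Implicit Arguments.
Unset Strict Implicit.
Unset Printing Implicit Defensive.

Import Order.TTheory GRing.Theory Num.Theory.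
Import numFieldNormedType.Exports.

Local Open Scope classical_set_scope.
Local Open Scope ring_scope.

(* Write rho for the homogeneous norm and w = |grad_G rho|^2 = |x|^2 / rho^2,
   which is invariant under the dilations delta_l (x, t) = (l x, l^2 t).  For a
   test function u and a point p <> 0 let u_p (y) be the value of u at the point
   of the dilation orbit of p whose norm is rho (y): this is a radial test
   function.  By Cauchy-Schwarz |grad_G u|^2 >= w (d_rho u)^2, with equality for
   radial functions.  Hence the inequality for u follows by averaging the
   inequalities for the u_p against w (p) m (rho p) dp, m the indicator function
   of an annulus up to a power of rho.  The average is computed without polar
   coordinates: for H >= 0 with H (0) = 0,
     int_p m (rho p) int_y H (delta_(rho y / rho p) p) w (y) dy dp = C int H
   follows from Tonelli's theorem and the scaling of Lebesgue measure under
   dilations only. *)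

(** * Functions of class C^k on an open set *)

(** At y the densities of u_p carry w (y), while those of u at the matching point of the orbit carry
    w (p): hence the factor w (p) in the average. Two obstacles shape the rest. First, W is known
    only through integrals: the potential density of u is merely equal to a Borel function off some
    null set N. As u_p sees u only on one orbit, itself a null set, N could spoil a given u_p; the
    averaging identity applied to the indicator function of N shows that it spoils almost none of
    them. Second, the positive and negative parts of the potential may have infinite integrals, so
    they are averaged separately, in an inequality where the negative part has been moved next to
    the energy. With Q = n + 2, the power rho^(-Q) in m cancels the Jacobian of y -> delta_(rho p)
    y. What is left in C is an integral of w rho^(-Q); this density is homogeneous of degree -Q, so
    its integral diverges both at 0 and at infinity, and restricting it to an annulus gives 0 < C <
    oo. *)

Section near_eq_differentiable.
Context (R : realType) (V W : normedModType R).

Lemma near_eq_differentiable (f g : V -> W) z : (\near z, f z = g z) ->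
  differentiable f z -> differentiable g z.
Proof.
move=> fg /diff_locallyP[dfc dfE].
have fgz : f z = g z := nbhs_singleton fg.
have dgE : g \o shift z = cst (g z) + 'd f z +o_ 0 id.
  apply/eqaddoP => _/posnumP[e]; move/eqaddoP : dfE => /(_ _ (gt0 e)) dfe.
  have fg0 : \forall h \near 0, f (h + z) = g (h + z).
    by move: fg; rewrite (near_shift 0)/=; apply: filterS => h; rewrite subr0.
  near=> h.
  suff -> : (g \o shift z - (cst (g z) + 'd f z)) h =
            (f \o shift z - (cst (f z) + 'd f z)) h by near: h.
  rewrite !fctE /= fgz; congr (_ - _); apply/esym.
  by near: h.
by apply/diff_locallyP; rewrite (diff_unique dfc dgE).
Unshelve. all: by end_near. Qed.

End near_eq_differentiable.

Section Ck_on.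
Context (R : realType) (V : normedModType R).
Implicit Types (U : set V) (f g : V -> R).

(** [grushin_norm] is smooth only off the origin, so the smoothness of u_p is proved on two open
    sets and then glued. The function stays defined on all of [V], and so do its derivatives; only
    their behaviour at points of [U] is constrained. *)
Fixpoint Ck_on U (k : nat) f : Prop :=
  match k with
  | 0%N => forall z, U z -> {for z, continuous f}
  | j.+1 => (forall z, U z -> differentiable f z) /\
            (forall v, Ck_on U j ('D_v f))
  end.

Lemma Ck_onT k f : Ck_on setT k f <-> Ck k f.
Proof.
elim: k f => [|k IH] f /=; first by split=> [h z|h z _]; exact: h.
split=> -[df h]; split=> [z|v].
- exact: df.
- exact/IH.
- by move=> _; exact: df.
- exact/IH.
Qed.

Lemma Ck_on_glue U1 U2 k f : (forall z, U1 z \/ U2 z) ->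
  Ck_on U1 k f -> Ck_on U2 k f -> Ck k f.
Proof.
move=> U12; elim: k f => [|k IH] f /=.
  by move=> h1 h2 z; case: (U12 z); [exact: h1|exact: h2].
move=> [d1 h1] [d2 h2]; split=> [z|v]; last exact: IH.
by case: (U12 z); [exact: d1|exact: d2].
Qed.

Lemma Ck_onS U k f : Ck_on U k.+1 f -> Ck_on U k f.
Proof.
elim: k f => [|k IH] f.
  by move=> [df _] z Uz; exact/differentiable_continuous/df.
by move=> [df h]; split=> // v; exact/IH.
Qed.

Section open.
Context (U : set V) (oU : open U).

Lemma eq_near_open f g z : (forall y, U y -> f y = g y) -> U z ->
  \near z, f z = g z.
Proof.
by move=> fg Uz; near=> y; apply: fg; near: y; exact: open_nbhs_nbhs.
Unshelve. all: by end_near. Qed.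

(** The product and chain rules give ['D_v f] only at points of [U]. As [U] is open, functions equal
    on [U] have equal derivatives there, so inductions on [k] can pass through such formulas. *)
Lemma eq_Ck_on k f g : (forall y, U y -> f y = g y) -> Ck_on U k f ->
  Ck_on U k g.
Proof.
elim: k f g => [|k IH] f g fg /=.
  move=> cf z Uz; have := cf _ Uz; rewrite /prop_for /continuous_at (fg _ Uz).
  by apply: cvg_trans; apply: near_eq_cvg; apply: eq_near_open.
move=> [df h]; split=> [z Uz|v].
  by apply: near_eq_differentiable (df _ Uz); exact: eq_near_open.
apply: IH (h v) => y Uy; apply: near_eq_derive; exact: eq_near_open.
Qed.

Lemma Ck_on_cst k (c : R) : Ck_on U k (cst c).
Proof.
elim: k c => [|k IH] c /=; first by move=> z _; exact: cvg_cst.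
split=> [z _|v]; first exact: differentiable_cst.
by rewrite (_ : 'D_v (cst c) = cst 0)//; apply/funext => z; rewrite derive_cst.
Qed.

Lemma Ck_on_linear k (f : {linear V -> R}) : continuous f -> Ck_on U k f.
Proof.
move=> cf; case: k => [|k]/=; first by move=> z _; exact: cf.
split=> [z _|v]; first exact: linear_differentiable.
rewrite (_ : 'D_v f = cst (f v)); first exact: Ck_on_cst.
apply/funext => z; rewrite deriveE; last exact: linear_differentiable.
by rewrite diff_lin.
Qed.

Lemma Ck_onD k f g : Ck_on U k f -> Ck_on U k g -> Ck_on U k (f + g).
Proof.
elim: k f g => [|k IH] f g /=.
  by move=> cf cg z Uz; apply: cvgD; [exact: cf|exact: cg].
move=> [df hf] [dg hg]; split=> [z Uz|v].
  by apply: differentiableD; [exact: df|exact: dg].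
apply: eq_Ck_on (IH _ _ (hf v) (hg v)) => z Uz.
by rewrite deriveD//; apply: diff_derivable; [exact: df|exact: dg].
Qed.

Lemma Ck_onM k f g : Ck_on U k f -> Ck_on U k g -> Ck_on U k (f * g).
Proof.
elim: k f g => [|k IH] f g /=.
  by move=> cf cg z Uz; apply: cvgM; [exact: cf|exact: cg].
move=> kf kg; have [df hf] := kf; have [dg hg] := kg; split=> [z Uz|v].
  by apply: differentiableM; [exact: df|exact: dg].
have h : Ck_on U k (f * 'D_v g + g * 'D_v f).
  by apply: Ck_onD; apply: IH => //; exact: Ck_onS.
apply: eq_Ck_on h => z Uz.
by rewrite deriveM//; apply: diff_derivable; [exact: df|exact: dg].
Qed.

Lemma Ck_on_sum k (I : Type) (s : seq I) (F : I -> V -> R) :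
  (forall i, Ck_on U k (F i)) -> Ck_on U k (\sum_(i <- s) F i).
Proof.
move=> hF; elim: s => [|i s IH].
  rewrite big_nil; apply: Ck_on_cst.
by rewrite big_cons; exact: Ck_onD.
Qed.

Lemma derive_powR f (a : R) z v : differentiable f z -> 0 < f z ->
  differentiable (fun y => f y `^ a) z /\
  'D_v (fun y => f y `^ a) z = a * f z `^ (a - 1) * 'D_v f z.
Proof.
move=> df f0; pose p (s : R) := s `^ a.
have [pd pE] := is_derive1_powR a f0.
have dp : differentiable p (f z) by exact/derivable1_diffP.
split; first exact: (@differentiable_comp _ _ _ _ f p).
rewrite deriveE; last exact: (@differentiable_comp _ _ _ _ f p).
rewrite (@diff_comp _ _ _ _ f p)//= -(deriveE _ df).
by rewrite deriv1E// derive1E pE [RHS]mulrC.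
Qed.

Lemma Ck_on_powR k f (a : R) : (forall z, U z -> 0 < f z) ->
  Ck_on U k f -> Ck_on U k (fun z => f z `^ a).
Proof.
move=> f0; elim: k a => [|k IH] a.
  move=> cf z Uz; have [pd _] := is_derive1_powR a (f0 _ Uz).
  rewrite (_ : (fun _ => _) = (fun s : R => s `^ a) \o f)//.
  apply: continuous_comp; first exact: cf.
  by apply: differentiable_continuous; exact/derivable1_diffP.
move=> kf; have [df hf] := kf; split=> [z Uz|v].
  by have [] := derive_powR a 0 (df _ Uz) (f0 _ Uz).
have h : Ck_on U k (cst a * (fun z => f z `^ (a - 1)) * 'D_v f).
  apply: Ck_onM (hf v); apply: Ck_onM; first exact: Ck_on_cst.
  exact/IH/Ck_onS.
apply: eq_Ck_on h => z Uz.
by have [_ ->] := derive_powR a v (df _ Uz) (f0 _ Uz).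
Qed.

Section comp.
Context (V' : normedModType R) (a b : V -> R) (e1 e2 : V').

(** This form of the chain rule is tailored to u_p: for p = (x, t), u_p (y) is the value of u at
    [a y *: (x, 0) + b y *: (0, t)], where [a] is rho / rho (p) and [b] is its square. *)
Lemma derive_comp2 (u : V' -> R) z v : differentiable a z ->
  differentiable b z ->
  differentiable u (a z *: e1 + b z *: e2) ->
  differentiable (fun y => u (a y *: e1 + b y *: e2)) z /\
  'D_v (fun y => u (a y *: e1 + b y *: e2)) z =
    'D_v a z * 'D_e1 u (a z *: e1 + b z *: e2)
    + 'D_v b z * 'D_e2 u (a z *: e1 + b z *: e2).
Proof.
move=> da db du; pose g y := a y *: e1 + b y *: e2.
have da' : differentiable (fun y => a y *: e1) z by exact: differentiableZl.
have db' : differentiable (fun y => b y *: e2) z by exact: differentiableZl.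
have dg : differentiable g z by exact: differentiableD.
split; first exact: (@differentiable_comp _ _ _ _ g u).
rewrite deriveE; last exact: (@differentiable_comp _ _ _ _ g u).
rewrite (@diff_comp _ _ _ _ g u)//=
  (_ : 'd g z v = 'd a z v *: e1 + 'd b z v *: e2).
  by rewrite linearD !linearZ/= -!deriveE.
rewrite (_ : g = (fun y => a y *: e1) + (fun y => b y *: e2))//.
by rewrite (diffD da' db')/= !diffZl.
Qed.

Lemma Ck_on_comp2 k (u : V' -> R) : Ck k u -> Ck_on U k a -> Ck_on U k b ->
  Ck_on U k (fun z => u (a z *: e1 + b z *: e2)).
Proof.
elim: k u => [|k IH] u.
  move=> cu ca cb z Uz.
  apply: (@continuous_comp _ _ _ (fun z => a z *: e1 + b z *: e2) u).
    by apply: cvgD; apply: cvgZr_tmp; [exact: ca|exact: cb].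
  exact: cu.
move=> [du hu] ka kb; have [da ha] := ka; have [db hb] := kb.
split=> [z Uz|v].
  by have [] := derive_comp2 0 (da _ Uz) (db _ Uz) (du _).
have h : Ck_on U k
    ('D_v a * (fun z => 'D_e1 u (a z *: e1 + b z *: e2))
     + 'D_v b * (fun z => 'D_e2 u (a z *: e1 + b z *: e2))).
  have [ka' kb'] := (Ck_onS ka, Ck_onS kb).
  by apply: Ck_onD; apply: Ck_onM;
    [exact: ha|exact: (IH _ (hu e1))|exact: hb|exact: (IH _ (hu e2))].
apply: eq_Ck_on h => z Uz.
by have [_ ->] := derive_comp2 v (da _ Uz) (db _ Uz) (du _).
Qed.

End comp.
End open.
End Ck_on.

(** * Grushin calculus *)

Section grushin_calculus.
Context (R : realType) (n : nat).
Local Notation Z := ('rV[R]_n * R)%type.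
Implicit Types (z y : Z) (u : Z -> R).

Definition coord_x (i : 'I_n) z : R := z.1 ord0 i.

Definition coord_t z : R := z.2.

Fact coord_x_is_linear i : linear (coord_x i).
Proof. by move=> a y z; rewrite /coord_x/= !mxE. Qed.

HB.instance Definition _ i :=
  GRing.isLinear.Build R Z R _ (coord_x i) (coord_x_is_linear i).

Fact coord_t_is_linear : linear coord_t.
Proof. by move=> a y z. Qed.

HB.instance Definition _ := GRing.isLinear.Build R Z R _ coord_t
  coord_t_is_linear.

Lemma continuous_coord_x i : continuous (coord_x i).
Proof.
move=> z; apply: (@continuous_comp _ _ _ fst (fun x : 'rV[R]_n => x ord0 i)).
  exact: cvg_fst.
exact: coord_continuous.
Qed.

Lemma continuous_coord_t : continuous coord_t.
Proof. by move=> z; exact: cvg_snd. Qed.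

(** This is rho^4, a polynomial, hence smooth at the origin too. It is written in the algebra of
    functions so that the closure properties of [Ck_on] and the derivation instances apply to it
    directly. *)
Definition quartic : Z -> R :=
  (\sum_(i < n) coord_x i * coord_x i) * (\sum_(i < n) coord_x i * coord_x i)
  + cst 4 * (coord_t * coord_t).

Lemma sum_sq_ge0 (x : 'rV[R]_n) : 0 <= \sum_(i < n) x ord0 i ^+ 2.
Proof. by apply: sumr_ge0 => i _; exact: sqr_ge0. Qed.

Lemma sqr_enorm (x : 'rV[R]_n) : enorm x ^+ 2 = \sum_(i < n) x ord0 i ^+ 2.
Proof. by rewrite sqr_sqrtr// sum_sq_ge0. Qed.

Lemma enorm_ge0 (x : 'rV[R]_n) : 0 <= enorm x.
Proof. exact: sqrtr_ge0. Qed.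

Lemma enorm_eq0 (x : 'rV[R]_n) : enorm x = 0 -> x = 0.
Proof.
move=> x0; have : enorm x ^+ 2 = 0 by rewrite x0 expr0n.
rewrite sqr_enorm => /eqP; rewrite psumr_eq0; last
  by move=> i _; exact: sqr_ge0.
move=> /allP h; apply/rowP => i; rewrite mxE.
by have := h i (mem_index_enum _); rewrite /= expf_eq0/= => /eqP.
Qed.

Lemma quarticE z : quartic z = enorm z.1 ^+ 4 + 4 * z.2 ^+ 2.
Proof.
rewrite /quartic !fctE -!expr2 -[4%N]/(2 * 2)%N [in RHS]exprM sqr_enorm.
by congr (_ ^+ 2 + _); rewrite fct_sumE.
Qed.

Lemma grushin_normE z : grushin_norm z = quartic z `^ 4^-1.
Proof. by rewrite quarticE. Qed.

Lemma quartic_ge0 z : 0 <= quartic z.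
Proof.
by rewrite quarticE addr_ge0 ?exprn_ge0 ?enorm_ge0// mulr_ge0// sqr_ge0.
Qed.

Lemma quartic_eq0 z : (quartic z == 0) = (z == 0).
Proof.
apply/eqP/eqP => [|->]; last first.
  rewrite quarticE/= /enorm big1 ?sqrtr0 ?expr0n ?mulr0 ?addr0//= => i _.
  by rewrite mxE expr0n.
case: z => x t; rewrite quarticE/= => /eqP.
have e4 : 0 <= enorm x ^+ 4 by rewrite exprn_ge0 ?enorm_ge0.
have t2 : 0 <= 4 * t ^+ 2 by rewrite mulr_ge0 ?sqr_ge0.
rewrite (paddr_eq0 e4 t2) [4 * _ == 0]mulf_eq0 !expf_eq0 pnatr_eq0/= =>
  /andP[x0 /eqP ->].
by rewrite (enorm_eq0 (eqP x0)).
Qed.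

Lemma quartic_gt0 z : (0 < quartic z) = (z != 0).
Proof. by rewrite lt_neqAle quartic_ge0 andbT eq_sym quartic_eq0. Qed.

Lemma grushin_norm_ge0 z : 0 <= grushin_norm z.
Proof. exact: powR_ge0. Qed.

Lemma grushin_norm_gt0 z : (0 < grushin_norm z) = (z != 0).
Proof.
apply/idP/idP => [|z0]; last by rewrite grushin_normE powR_gt0// quartic_gt0.
apply: contraTN => /eqP ->; rewrite grushin_normE.
by have /eqP -> : quartic 0 == 0; rewrite ?quartic_eq0// powR0// ltxx.
Qed.

Lemma grushin_norm_X4 z : grushin_norm z ^+ 4 = quartic z.
Proof.
rewrite grushin_normE -powR_mulrn ?powR_ge0// -powRrM mulVf// powRr1//.
exact: quartic_ge0.
Qed.

Lemma grushin_norm_inj4 y z :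
  grushin_norm y = grushin_norm z <-> quartic y = quartic z.
Proof.
by split=> [|h]; [rewrite -!grushin_norm_X4 => ->|rewrite !grushin_normE h].
Qed.

Definition dilation (l : R) z : Z := (l *: z.1, l ^+ 2 * z.2).

Lemma enormZ (l : R) (x : 'rV[R]_n) : enorm (l *: x) = `|l| * enorm x.
Proof.
rewrite /enorm -sqrtr_sqr -sqrtrM ?sqr_ge0//; congr Num.sqrt.
by rewrite mulr_sumr; apply: eq_bigr => i _; rewrite mxE exprMn.
Qed.

Lemma grushin_norm_dilation l z : 0 <= l ->
  grushin_norm (dilation l z) = l * grushin_norm z.
Proof.
move=> l0; apply/eqP; rewrite -(@eqrXn2 _ 4)//; last 2 first.
- exact: grushin_norm_ge0.
- by rewrite mulr_ge0// grushin_norm_ge0.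
by rewrite exprMn !grushin_norm_X4 !quarticE/= enormZ ger0_norm//; apply/eqP;
  ring.
Qed.

Definition weight z : R := enorm z.1 ^+ 2 / grushin_norm z ^+ 2.

Lemma weight_ge0 z : 0 <= weight z.
Proof. by rewrite divr_ge0// sqr_ge0. Qed.

Lemma weight0 : weight 0 = 0.
Proof.
rewrite /weight sqr_enorm big1 ?mul0r// => i _.
by rewrite mxE expr0n.
Qed.

Lemma weight_dilation l z : 0 < l -> weight (dilation l z) = weight z.
Proof.
move=> l0; rewrite /weight grushin_norm_dilation ?ltW//= enormZ gtr0_norm//.
by rewrite !exprMn -mulf_div divff ?mul1r// expf_neq0// gt_eqF.
Qed.

Lemma open_neq0 : open [set z : Z | z != 0].
Proof.
rewrite (_ : mkset _ = ~` [set 0]); last first.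
  by apply/seteqP; split=> z /=; move/eqP.
apply/closed_openC/accessible_closed_set1/hausdorff_accessible.
exact: norm_hausdorff.
Qed.

Lemma Ck_on_quartic U k : open U -> Ck_on U k quartic.
Proof.
move=> oU; have cx i : Ck_on U k (coord_x i).
  by apply: Ck_on_linear => //; exact: continuous_coord_x.
have ct : Ck_on U k coord_t
  by apply: Ck_on_linear => //; exact: continuous_coord_t.
have cs : Ck_on U k (\sum_(i < n) coord_x i * coord_x i).
  by apply: Ck_on_sum => // i; exact: Ck_onM.
by apply: Ck_onD; [exact: oU|exact: Ck_onM|apply: Ck_onM => //;
  [exact: Ck_on_cst|exact: Ck_onM]].
Qed.

Lemma continuous_quartic : continuous quartic.
Proof. by have /Ck_onT := @Ck_on_quartic setT 0%N openT. Qed.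

Lemma differentiable_quartic z : differentiable quartic z.
Proof. by have [dq _] := @Ck_on_quartic setT 1%N openT; exact: dq. Qed.

Lemma Ck_on_grushin_norm k : Ck_on [set z : Z | z != 0] k (@grushin_norm R n).
Proof.
rewrite (_ : @grushin_norm R n = fun z => quartic z `^ 4^-1).
  apply: Ck_on_powR; first exact: open_neq0.
    by move=> z /=; rewrite quartic_gt0.
  exact/Ck_on_quartic/open_neq0.
by apply/funext => z; exact: grushin_normE.
Qed.

Lemma differentiable_grushin_norm z : z != 0 ->
  differentiable (@grushin_norm R n) z.
Proof. by move=> z0; have [dg _] := Ck_on_grushin_norm 1; exact: dg. Qed.

Lemma derive_quartic z v : 'D_v quartic z =
  4 * enorm z.1 ^+ 2 * (\sum_(i < n) z.1 ord0 i * v.1 ord0 i) + 8 * z.2 * v.2.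
Proof.
have lin (f : {linear Z -> R}) : continuous f ->
  differentiable f z /\ 'D_v f z = f v.
  move=> cf; have df := linear_differentiable z cf.
  by rewrite (deriveE _ df) diff_lin.
have {}lin (f : {linear Z -> R}) : continuous f -> is_derive z v f (f v).
  by move=> /lin[/diff_derivable df <-]; exact: DeriveDef.
(* With these instances in the context, [derive_val] differentiates the polynomial by instance
   resolution. *)
have dx i := lin _ (@continuous_coord_x i).
have dt := lin _ continuous_coord_t.
rewrite /quartic derive_val !fctE/= !scaler0 ?addr0.
rewrite (_ : (\sum_(i < n) coord_x i * coord_x i) z = enorm z.1 ^+ 2);
  last first.
  by rewrite sqr_enorm fct_sumE; apply: eq_bigr => i _; rewrite expr2.
rewrite (_ : \sum_(i < n) _ = 2 * \sum_(i < n) z.1 ord0 i * v.1 ord0 i);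
  last first.
  by rewrite mulr_sumr; apply: eq_bigr => i _; rewrite mulr2n mulrDl mul1r.
rewrite /GRing.scale/= /coord_t; ring.
Qed.

Lemma derive_grushin_norm z v : z != 0 -> 'D_v (@grushin_norm R n) z =
  (enorm z.1 ^+ 2 * (\sum_(i < n) z.1 ord0 i * v.1 ord0 i) + 2 * z.2 * v.2)
    / grushin_norm z ^+ 3.
Proof.
move=> z0; have g0 : 0 < grushin_norm z by rewrite grushin_norm_gt0.
have q0 : 0 < quartic z by rewrite quartic_gt0.
rewrite (_ : @grushin_norm R n = fun z => quartic z `^ 4^-1); last first.
  by apply/funext => y; exact: grushin_normE.
have [_ ->] := derive_powR 4^-1 v (differentiable_quartic z) q0.
rewrite derive_quartic -grushin_normE.
rewrite powRB; last by rewrite (gt_eqF q0) implybT.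
rewrite powRr1 ?quartic_ge0// -grushin_normE -grushin_norm_X4.
by field; rewrite gt_eqF.
Qed.

(** The sum of squares is |x|^2 (|x|^4 + 4 t^2) / rho^6, and the parenthesis is rho^4. *)
Lemma sqnorm_grad_grushin_norm z : z != 0 ->
  sqnorm (grushin_grad (@grushin_norm R n) z) = weight z.
Proof.
move=> z0; have g0 : grushin_norm z != 0 by rewrite gt_eqF// grushin_norm_gt0.
have gx i : grad_x (@grushin_norm R n) z ord0 i =
    enorm z.1 ^+ 2 * z.1 ord0 i / grushin_norm z ^+ 3.
  rewrite mxE derive_grushin_norm//= mulr0 addr0 (bigD1 i)//= big1 ?addr0.
    by rewrite mxE !eqxx mulr1.
  by move=> j ji; rewrite mxE (negbTE ji) mulr0.
have gt : d_t (@grushin_norm R n) z = 2 * z.2 / grushin_norm z ^+ 3.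
  rewrite /d_t derive_grushin_norm//= big1 ?mulr0 ?add0r ?mulr1//.
  by move=> j _; rewrite mxE mulr0.
rewrite /sqnorm /grushin_grad/= gt sqr_enorm.
rewrite (eq_bigr (fun i => (enorm z.1 ^+ 2 / grushin_norm z ^+ 3) ^+ 2
    * z.1 ord0 i ^+ 2)); last by move=> i _; rewrite gx -exprMn mulrAC.
rewrite -mulr_sumr -sqr_enorm /weight.
have := grushin_norm_X4 z; rewrite quarticE.
move: (enorm z.1) (z.2) (grushin_norm z) g0 => e t g g0 h.
have -> : e ^+ 2 / g ^+ 2 = e ^+ 2 * g ^+ 4 / g ^+ 6 by field.
by rewrite h; field.
Qed.

(** This is d/d rho along dilation orbits: (x, 2 t) is the velocity of (l x, l^2 t) at l = 1, and
    rho grows at rate rho along it. *)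
Definition radial_derivative u z : R := 'D_(z.1, 2 * z.2) u z / grushin_norm z.

Lemma cauchy_schwarz (a b : 'I_n -> R) :
  (\sum_(i < n) a i * b i) ^+ 2 <= (\sum_(i < n) a i ^+ 2)
    * (\sum_(i < n) b i ^+ 2).
Proof.
set A := \sum_(i < n) a i ^+ 2; set B := \sum_(i < n) b i ^+ 2;
  set P := \sum_(i < n) _.
have A0 : 0 <= A by apply: sumr_ge0 => i _; exact: sqr_ge0.
have B0 : 0 <= B by apply: sumr_ge0 => i _; exact: sqr_ge0.
have [A_eq0|A_neq0] := eqVneq A 0.
  suff -> : P = 0 by rewrite expr0n mulr_ge0.
  apply: big1 => i _.
  have : A == 0 by rewrite A_eq0.
  rewrite psumr_eq0 => [/allP/(_ i)|j _]; last exact: sqr_ge0.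
  by rewrite mem_index_enum/= expf_eq0/= => /(_ isT)/eqP ->; rewrite mul0r.
have {A_neq0}A_gt0 : 0 < A by rewrite lt_neqAle eq_sym A_neq0.
have : 0 <= \sum_(i < n) (A * b i - P * a i) ^+ 2.
  by apply: sumr_ge0 => i _; exact: sqr_ge0.
rewrite (_ : \sum_(i < n) _ = A * (A * B - P ^+ 2)).
  by rewrite pmulr_rge0// subr_ge0.
rewrite (eq_bigr (fun i => A ^+ 2 * b i ^+ 2 + (- (2 * A * P)) * (a i * b i)
  + P ^+ 2 * a i ^+ 2)); last by move=> i _; ring.
by rewrite !big_split/= -!mulr_sumr -/A -/B -/P; ring.
Qed.

Lemma derive_coordE u z (x : 'rV[R]_n) (s : R) : differentiable u z ->
  'D_(x, s) u z = \sum_(i < n) x ord0 i * grad_x u z ord0 i + s * d_t u z.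
Proof.
move=> du; rewrite (_ : (x, s) = \sum_(i < n) x ord0 i *: basis_x R i
  + s *: basis_t R n).
  rewrite (deriveE _ du) linearD linear_sum; congr (_ + _).
    by apply: eq_bigr => i _; rewrite linearZ/= mxE (deriveE _ du).
  by rewrite linearZ/= /d_t (deriveE _ du).
rewrite [RHS]surjective_pairing/=; congr pair.
  rewrite (raddf_sum fst)/= scaler0 addr0 [LHS]row_sum_delta.
  by apply: eq_bigr => i _.
by rewrite (raddf_sum snd)/= big1 ?add0r ?scaler1 => [|i _];
  rewrite /GRing.scale/= ?mulr0 ?mulr1.
Qed.

(** Off the origin, the scalar product of grad_G u and grad_G rho is w times the radial derivative
    of u, and |grad_G rho|^2 = w; so this is Cauchy-Schwarz divided by w. The proof clears
    denominators in order to cover w = 0 as well. *)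
Lemma radial_derivative_le u z : differentiable u z ->
  radial_derivative u z ^+ 2 * weight z <= sqnorm (grushin_grad u z).
Proof.
move=> du; have [->|z0] := eqVneq z 0.
  by rewrite weight0 mulr0 addr_ge0 ?sqr_ge0.
have g0 : 0 < grushin_norm z by rewrite grushin_norm_gt0.
rewrite /radial_derivative /weight derive_coordE// /sqnorm /grushin_grad/=.
have := cauchy_schwarz (fun i => z.1 ord0 i) (fun i => grad_x u z ord0 i).
rewrite -!sqr_enorm; set P := \sum_(i < n) _; set a := d_t u z.
set A := enorm (grad_x u z).
have := grushin_norm_X4 z; rewrite quarticE.
move: (enorm z.1) (z.2) (grushin_norm z) g0 => e t g g0 h cs.
rewrite (_ : (_ / g) ^+ 2 * _ = (P + 2 * t * a) ^+ 2 * e ^+ 2 / g ^+ 4);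
  last first.
  by field; rewrite gt_eqF.
rewrite ler_pdivrMr ?exprn_gt0// h.
have [->|e0] := eqVneq e 0.
  rewrite !expr0n/= mulr0 mulr_ge0// ?addr_ge0 ?sqr_ge0//.
  by rewrite mulr_ge0 ?sqr_ge0.
have e2 : 0 < e ^+ 2 by rewrite exprn_even_gt0.
rewrite -(ler_pM2r e2) -subr_ge0.
(* The first term is the defect in Cauchy-Schwarz on R^n; the second is the square left over between
   the x and t components. *)
rewrite (_ : _ - _ = (e ^+ 2 * A ^+ 2 - P ^+ 2) * (e ^+ 4 + 4 * t ^+ 2)
   + (e ^+ 4 * a - 2 * t * P) ^+ 2); last by ring.
rewrite addr_ge0 ?sqr_ge0// mulr_ge0 ?subr_ge0//.
have e4 : 0 <= e ^+ 4 by rewrite exprn_even_ge0.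
have t2 : 0 <= t ^+ 2 by rewrite sqr_ge0.
lra.
Qed.

End grushin_calculus.

(** * The radial functions u_p *)

Section along_ray.
Context (R : realType) (n : nat).
Local Notation Z := ('rV[R]_n * R)%type.
Implicit Types (z y p : Z) (u : Z -> R).

(* The point of the dilation orbit of [p] with the same norm as [y]: in polar
   coordinates, the radius of [y] and the direction of [p]. *)
Definition on_ray p y : Z := dilation (grushin_norm y / grushin_norm p) p.

Definition along_ray u p y : R := u (on_ray p y).

Lemma grushin_norm_on_ray p y : p != 0 ->
  grushin_norm (on_ray p y) = grushin_norm y.
Proof.
move=> p0; have g0 : 0 < grushin_norm p by rewrite grushin_norm_gt0.
by rewrite grushin_norm_dilation ?divfK ?gt_eqF// divr_ge0 ?grushin_norm_ge0.
Qed.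

Lemma grushin_norm0 : @grushin_norm R n 0 = 0.
Proof.
by apply/eqP; rewrite eq_le grushin_norm_ge0 andbT leNgt grushin_norm_gt0 eqxx.
Qed.

Lemma on_ray0 p : on_ray p 0 = 0.
Proof.
by rewrite /on_ray grushin_norm0 mul0r /dilation scale0r expr0n/= mul0r.
Qed.

Lemma weight_on_ray p y : p != 0 -> y != 0 -> weight (on_ray p y) = weight p.
Proof.
by move=> p0 y0; rewrite weight_dilation// divr_gt0// grushin_norm_gt0.
Qed.

Lemma radial_along_ray u p : radial (along_ray u p).
Proof. by exists (fun s => u (dilation (s / grushin_norm p) p)). Qed.

Let scale p : Z -> R := @grushin_norm R n * cst (grushin_norm p)^-1.

Let along_rayE u p : along_ray u p =
  fun y => u (scale p y *: (p.1, 0) + (scale p * scale p) y *: (0, p.2)).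
Proof.
apply/funext => y; rewrite /along_ray /on_ray /dilation; congr u.
rewrite [RHS]surjective_pairing/= scaler0 scaler0 addr0 add0r.
by rewrite /scale expr2.
Qed.

Let Ck_on_scale p k : Ck_on [set z : Z | z != 0] k (scale p).
Proof.
by apply: Ck_onM; [exact: open_neq0|exact: Ck_on_grushin_norm|exact: Ck_on_cst].
Qed.

Lemma Ck_on_along_ray u p k : Ck k u ->
  Ck_on [set z : Z | z != 0] k (along_ray u p).
Proof.
move=> ku; rewrite along_rayE; apply: Ck_on_comp2 => //; first exact: open_neq0.
by apply: Ck_onM => //; exact: open_neq0.
Qed.

Lemma derive_along_ray u p y v : (forall z, differentiable u z) ->
  p != 0 -> y != 0 ->
  'D_v (along_ray u p) y =
    'D_v (@grushin_norm R n) y * radial_derivative u (on_ray p y).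
Proof.
move=> du p0 y0; rewrite along_rayE.
have gp : 0 < grushin_norm p by rewrite grushin_norm_gt0.
have gy : 0 < grushin_norm y by rewrite grushin_norm_gt0.
have dg := differentiable_grushin_norm y0.
have ds : differentiable (scale p) y.
  by apply: differentiableM => //; exact: differentiable_cst.
have dss : differentiable (scale p * scale p) y by exact: differentiableM.
have Ds : 'D_v (scale p) y = 'D_v (@grushin_norm R n) y / grushin_norm p.
  rewrite /scale deriveM; [|exact: diff_derivable|
    exact/diff_derivable/differentiable_cst].
  by rewrite derive_cst scaler0 add0r mulrC.
have [_ ->] := @derive_comp2 _ _ _ _ _ (p.1, 0) (0, p.2) u y v ds dss (du _).
have dsv : derivable (scale p) y v by exact: diff_derivable.
rewrite (deriveM dsv dsv).
rewrite Ds /radial_derivative grushin_norm_on_ray//.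
rewrite [X in 'D_(p.1, 0) u X](_ : _ = on_ray p y); last first.
  rewrite [LHS]surjective_pairing/= scaler0 scaler0 addr0 add0r.
  by rewrite /on_ray /dilation /scale expr2.
rewrite [X in 'D_(0, p.2) u X](_ : _ = on_ray p y); last first.
  rewrite [LHS]surjective_pairing/= scaler0 scaler0 addr0 add0r.
  by rewrite /on_ray /dilation /scale expr2.
rewrite (_ : ((on_ray p y).1, 2 * (on_ray p y).2) = scale p y *: (p.1, 0)
    + (2 * scale p y ^+ 2) *: (0, p.2)); last first.
  rewrite [RHS]surjective_pairing/= scaler0 scaler0 addr0 add0r.
  by rewrite /scale mulrA.
move: (on_ray p y) => z.
rewrite !(deriveE _ (du z)) linearD !linearZ/= /scale/= /GRing.scale/=.
move: ('d u z _) ('d u z _) ('D_v _ y) => A B C; rewrite !fctE.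
by field; rewrite !gt_eqF.
Qed.

Lemma sqnorm_grad_along_ray u p y : (forall z, differentiable u z) ->
  p != 0 -> y != 0 ->
  sqnorm (grushin_grad (along_ray u p) y) =
    radial_derivative u (on_ray p y) ^+ 2 * weight y.
Proof.
move=> du p0 y0; rewrite -sqnorm_grad_grushin_norm// /sqnorm/= !sqr_enorm.
rewrite mulrDr mulr_sumr; congr (_ + _).
  by apply: eq_bigr => i _; rewrite !mxE derive_along_ray// exprMn mulrC.
by rewrite /d_t derive_along_ray// mulrA exprMn mulrC.
Qed.

Lemma quartic_le_coord_bound (M : R) z : quartic z <= M ->
  (forall i, - (1 + `|M|) <= z.1 ord0 i <= 1 + `|M|) /\
  - (1 + `|M|) <= z.2 <= 1 + `|M|.
Proof.
(* This bound is at least 1 and exceeds [M], so |s| > m would give |s|^k >= |s| > M for every k > 0;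
   the same box serves x and t, and no roots are taken. *)
set m := 1 + `|M|; case: z => x t; rewrite quarticE/= => h.
have Mm : M < m by rewrite (le_lt_trans (ler_norm M))// ltrDr.
have bnd k (s : R) : (0 < k)%N -> `|s| ^+ k <= M -> - m <= s <= m.
  move=> k0 sM; rewrite -ler_norml leNgt; apply/negP => ms.
  have s1 : 1 <= `|s| by rewrite (le_trans _ (ltW ms))// lerDl.
  have : `|s| ^+ 1 <= `|s| ^+ k by rewrite ler_weXn2l.
  rewrite expr1 => /le_trans/(_ sM) sM'.
  by have := lt_le_trans (lt_trans Mm ms) sM'; rewrite ltxx.
have e4 : 0 <= enorm x ^+ 4 by rewrite exprn_even_ge0.
have t2 : 0 <= t ^+ 2 by rewrite sqr_ge0.
split=> [i|]; last by apply: (bnd 2%N) => //; rewrite real_normK ?num_real//;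
  lra.
apply: (bnd 4%N) => //; apply: (@le_trans _ _ (enorm x ^+ 4)); last by lra.
rewrite -[4%N]/(2 * 2)%N !exprM ler_pXn2r ?nnegrE ?sqr_ge0//.
rewrite real_normK ?num_real// sqr_enorm (bigD1 i)//= lerDl.
by apply: sumr_ge0 => j _; exact: sqr_ge0.
Qed.

Lemma compact_grushin_closed_bounded (D : set Z) (M : R) :
  closed D -> (forall z, D z -> quartic z <= M) -> compact D.
Proof.
move=> cD DM; pose m := 1 + `|M|.
have cS : compact `[- m, m]%classic by exact: segment_compact.
pose B : set Z :=
  [set x : 'rV[R]_n | forall i, `[- m, m]%classic (x ord0 i)]
  `*` `[- m, m]%classic.
apply: (@subclosed_compact _ D B) => //.
  by apply: compact_setX => //;
    exact: (@rV_compact _ _ (fun=> `[- m, m]%classic)).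
by move=> z /DM/quartic_le_coord_bound[zx zt]; split=> /= [i|];
  rewrite in_itv/=.
Qed.

(** u_p vanishes off [D], the union of the spheres of rho that meet the support [K] of u. [D] is
    closed, bounded, inside the ball and misses the origin because [K] does. Off the origin u_p is a
    composition of smooth maps, off [D] it is 0, and these two open sets cover the space. *)
Lemma test_function_along_ray (r : \bar R) u p : p != 0 ->
  test_function (grushin_ball r `\ 0) u ->
  test_function (grushin_ball r `\ 0) (along_ray u p).
Proof.
move=> p0 [su cK KB]; set K := closure _ in cK KB.
pose D := @quartic R n @^-1` (@quartic R n @` K).
have cqK : compact (@quartic R n @` K).
  by apply: continuous_compact => //; apply: continuous_subspaceT;
    exact: continuous_quartic.
have cD : closed D.
  apply: preimage_closed; first by move=> z _; exact: continuous_quartic.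
  exact: (compact_closed (@Rhausdorff R) cqK).
have uD y : along_ray u p y != 0 -> D y.
  move=> uy; exists (on_ray p y); first exact: subset_closure.
  by apply/grushin_norm_inj4; exact: grushin_norm_on_ray.
have DB : D `<=` grushin_ball r `\ 0.
  move=> y [z Kz] /grushin_norm_inj4 zy; have [zr z0] := KB _ Kz; split.
    by move: zr; rewrite /grushin_ball/= zy.
  move=> /= y0; apply: z0 => /=; apply/eqP;
    rewrite -[_ == _]negbK -grushin_norm_gt0.
  by rewrite zy y0 grushin_norm0 ltxx.
have clD : closure [set z | along_ray u p z != 0] `<=` D.
  by rewrite [X in _ `<=` X](closure_id D).1//; exact: closureS.
split=> [k| |].
- apply: (@Ck_on_glue _ _ [set z | z != 0] (~` D)).
  + move=> z; have [->|] := eqVneq z 0; last by left.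
    by right => /DB[_]; exact.
  + exact/Ck_on_along_ray/su.
  + apply: (@eq_Ck_on _ _ _ _ _ (cst 0)); first exact: closed_openC.
      by move=> y Dy /=; apply/esym/eqP; apply: contrapT => /negP/uD.
    exact: Ck_on_cst.
- have [M [_ MK]] := compact_bounded cqK.
  apply: (@compact_grushin_closed_bounded _ (M + 1));
    first exact: closed_closure.
  move=> z /clD qz; rewrite (le_trans (ler_norm _))//.
  by apply: (MK _ _ _ qz); rewrite ltrDl.
- exact: subset_trans clD DB.
Qed.

Lemma test_function_eq0 (U : set Z) u : test_function U u ->
  forall z, ~ U z -> u z = 0 /\ sqnorm (grushin_grad u z) = 0.
Proof.
move=> [_ _ KU] z Uz.
have u0 : \near z, cst 0 z = u z.
  have Kz : (~` closure [set y | u y != 0]) z by move=> /KU.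
  near=> y; have : (~` closure [set y | u y != 0]) y.
    by near: y; apply: open_nbhs_nbhs; split => //; apply: closed_openC;
      exact: closed_closure.
  by move=> Ky; apply/esym/eqP; apply: contrapT => /negP uy; apply: Ky;
    exact: subset_closure.
split; first by rewrite -(nbhs_singleton u0).
have D0 v : 'D_v u z = 0 by rewrite -(near_eq_derive v u0) derive_cst.
rewrite /sqnorm/= /d_t D0 mulr0 expr0n addr0 sqr_enorm big1// => i _.
by rewrite mxE D0 expr0n.
Unshelve. all: by end_near. Qed.

End along_ray.

(** * Scaling of Lebesgue measure *)

Section scaling.
Local Open Scope ereal_scope.
Context d (T : measurableType d) (R : realType).

(** The change of variables is stated for integrals of nonnegative functions rather than for
    measures of sets: in this form Tonelli carries it to products. *)
Definition scales_by (m : {measure set T -> \bar R}) (phi : T -> T) (c : R) :=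
  [/\ measurable_fun setT phi, (0 <= c)%R &
    forall f : T -> \bar R, measurable_fun setT f -> (forall x, 0 <= f x) ->
      \int[m]_x f (phi x) = c%:E * \int[m]_x f x].

End scaling.

Section product_scaling.
Local Open Scope ereal_scope.
Context d1 d2 (T1 : measurableType d1) (T2 : measurableType d2) (R : realType).
Context (m1 : {sigma_finite_measure set T1 -> \bar R}).
Context (m2 : {sigma_finite_measure set T2 -> \bar R}).

(** The product measure itself, packaged with the sigma-finiteness that exchanging integrals over
    two copies of it requires. *)
Definition sigma_finite_product :
    {sigma_finite_measure set (T1 * T2)%type -> \bar R} :=
  HB.pack (m1 \x m2) (Measure_isSigmaFinite.Build _ _ _ (m1 \x m2)
    (product_sigma_finite m1 m2)).

Lemma scales_by_prod phi1 phi2 c1 c2 :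
  scales_by m1 phi1 c1 -> scales_by m2 phi2 c2 ->
  scales_by (m1 \x m2) (fun z => (phi1 z.1, phi2 z.2)) (c1 * c2)%R.
Proof.
move=> [mphi1 c10 h1] [mphi2 c20 h2].
have mphi : measurable_fun setT (fun z : T1 * T2 => (phi1 z.1, phi2 z.2)).
  by apply/measurable_fun_pairP; split;
    [exact: (measurableT_comp mphi1 measurable_fst)|
     exact: (measurableT_comp mphi2 measurable_snd)].
split=> [//||f mf f0]; first exact: mulr_ge0.
rewrite fubini_tonelli1//; last exact: measurableT_comp.
rewrite [in RHS]fubini_tonelli1// /fubini_F/=.
transitivity (\int[m1]_x (c2%:E * \int[m2]_y f (phi1 x, y))).
  apply: eq_integral => x _; rewrite -(h2 (fun y => f (phi1 x, y)))//.
  exact: measurable_fun_pair2.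
have mF : measurable_fun setT (fun x => \int[m2]_y f (x, y)).
  exact: (measurable_fun_fubini_tonelli_F f mf f0).
have F0 x : 0 <= \int[m2]_y f (x, y) by exact: integral_ge0.
rewrite ge0_integralZl//; last exact: (measurableT_comp mF mphi1).
by rewrite (h1 _ mF F0) EFinM muleCA muleA.
Qed.

End product_scaling.

(** Transport of a scaling through an equivariant map; with [rV_cons] for [psi] it is the induction
    step from R x R^n to R^(n+1). *)
Lemma scales_by_pushforward d1 d2 (T1 : measurableType d1)
    (T2 : measurableType d2) (R : realType)
    (m1 : {measure set T1 -> \bar R}) (m2 : {measure set T2 -> \bar R})
    (psi : T1 -> T2) phi1 phi2 c :
  measurable_fun setT psi ->
  (forall A, measurable A -> m2 A = pushforward m1 psi A) ->
  (forall x, phi2 (psi x) = psi (phi1 x)) -> measurable_fun setT phi2 ->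
  scales_by m1 phi1 c -> scales_by m2 phi2 c.
Proof.
move=> mpsi m2E phiE mphi2 [_ c0 h]; split=> // f mf f0.
have E g : measurable_fun setT g -> (forall x, (0 <= g x)%E) ->
    (\int[m2]_x g x = \int[m1]_x g (psi x))%E.
  move=> mg g0.
  pose psi' : {mfun T1 >-> T2} :=
    HB.pack psi (isMeasurableFun.Build _ _ _ _ _ mpsi).
  rewrite (eq_measure_integral (pushforward m1 psi')) => [|A mA _];
    last exact: m2E.
  by rewrite ge0_integral_pushforward.
rewrite E// ?E//; last exact: measurableT_comp.
under eq_integral do rewrite phiE.
by rewrite (h (fun x => f (psi x)))//; exact: measurableT_comp.
Qed.

Section lebesgue_scaling.
Local Open Scope ereal_scope.
Context (R : realType).

Lemma scales_by_lebesgue (l : R) : (0 < l)%R ->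
  scales_by (@lebesgue_measure R) (fun x : R => (l * x)%R) l^-1.
Proof.
move=> l0; have mphi : measurable_fun setT
    (fun x : measurableTypeR R => (l * x)%R : measurableTypeR R).
  by apply: measurable_funM => //; exact: measurable_cst.
split=> [//||f mf f0]; first by rewrite invr_ge0 ltW.
pose phi : {mfun measurableTypeR R >-> measurableTypeR R} :=
  HB.pack (fun x : measurableTypeR R => (l * x)%R : measurableTypeR R)
    (isMeasurableFun.Build _ _ _ _ _ mphi).
(* By uniqueness it suffices to compare on half-open intervals, where the preimage of []a, b]] has
   length (b - a) / l. *)
have lE A : measurable A -> lebesgue_measure A =
    mscale (NngNum (ltW l0)) (pushforward lebesgue_measure phi) A.
  apply: (@lebesgue_measure_unique R) => _ [[a b]] _ <-.
  change (lebesgue_measure (`]a, b]%classic : set (measurableTypeR R)) =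
    l%:E * lebesgue_measure ((fun x : R => (l * x)%R) @^-1` `]a, b]%classic
      : set (measurableTypeR R))).
  rewrite [X in _ * lebesgue_measure X]
    (_ : _ = `](a / l)%R, (b / l)%R]%classic); last first.
    apply/seteqP; split=> x /=;
      rewrite !in_itv/= ltr_pdivrMr// ler_pdivlMr// [(x * l)%R]mulrC//.
  rewrite !lebesgue_measure_itv/= !lte_fin ltr_pM2r ?invr_gt0//.
  case: ifPn => _; last by rewrite mule0.
  by rewrite -EFinM -mulrBl mulrCA divff ?mulr1// gt_eqF.
rewrite [in RHS](eq_measure_integral
  (mscale (NngNum (ltW l0)) (pushforward lebesgue_measure phi))) =>
    [|A mA _]; last exact: lE.
rewrite ge0_integral_mscale//= ge0_integral_pushforward//=.
by rewrite muleA -EFinM mulVf ?gt_eqF// mul1e.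
Qed.

Lemma measurable_rV_scale n (l : R) :
  measurable_fun setT (fun x : 'rV[R]_n => l *: x)%R.
Proof.
apply: measurable_fun_rV => i;
  rewrite (_ : _ \o _ = fun x => l * rV_coord i x)%R.
  by apply: measurable_funM => //; exact: measurable_rV_coord.
by apply/funext => x; rewrite /rV_coord/= mxE.
Qed.

Lemma scales_by_rV_lebesgue n (l : R) : (0 < l)%R ->
  scales_by (rV_lebesgue R n) (fun x : 'rV[R]_n => l *: x)%R (l^-1 ^+ n).
Proof.
move=> l0; elim: n => [|n IH].
  split=> [||f mf f0]; first exact: measurable_rV_scale.
    by rewrite expr0.
  by rewrite !integral_dirac//= ?diracT ?expr0 ?mul1e ?scaler0//;
    apply: measurableT_comp => //; exact: measurable_rV_scale.
have := scales_by_prod (scales_by_lebesgue l0) IH; rewrite -exprS.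
apply: (@scales_by_pushforward _ _ _ _ _ _ _ (@rV_cons R n)) => //.
- exact: measurable_rV_cons.
- move=> [a x]; apply/rowP => i; rewrite !mxE.
  by case: unliftP => [j|] _ /=; rewrite ?mxE.
- exact: measurable_rV_scale.
Qed.

Lemma measurable_rV_box n (I : 'I_n -> set (measurableTypeR R)) :
  (forall i, measurable (I i)) ->
    measurable [set x : 'rV[R]_n | forall i, I i (x ord0 i)].
Proof.
move=> mI; rewrite (_ : mkset _ = \bigcap_i (@rV_coord R n i @^-1` I i)).
  apply: fin_bigcap_measurable => [|i _]; first exact: finite_finset.
  rewrite -[X in measurable X]setTI.
  exact: measurable_rV_coord.
by apply/seteqP; split=> x /= h i; [move=> _; exact: h|exact: (h i)].
Qed.

Lemma rV_lebesgue_cube n (I : set (measurableTypeR R)) : measurable I ->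
  rV_lebesgue R n [set x | forall i, I (x ord0 i)] = lebesgue_measure I ^+ n.
Proof.
move=> mI; elim: n => [|n IH].
  by rewrite /= diracE mem_set// => -[].
rewrite expeS -IH /= /rV_lebesgue_step /pushforward.
rewrite -product_measure1E//; last exact: (@measurable_rV_box n (fun=> I)).
congr (_ _); apply/seteqP; split => -[a x] /=.
  move=> h; split=> [|i]; first by have := h ord0; rewrite mxE unlift_none.
  by have := h (lift ord0 i); rewrite mxE liftK.
move=> [Ia Ix] i; rewrite mxE.
by case: unliftP => [j|] _ /=.
Qed.

End lebesgue_scaling.

(** * Borel measurability on the Grushin space *)

Section grushin_measurability.
Context (R : realType) (n : nat).
Local Notation Z := ('rV[R]_n * measurableTypeR R)%type.
Implicit Types (z y p : Z).

(** The sigma-algebra here is generated by the coordinates, not by the topology. The two are linked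
    by writing an open set as the countable union of the boxes with rational centre and radius 1 /
    (k + 1) that it contains. *)
Lemma measurable_open (A : set ('rV[R]_n * R)) : open A ->
  measurable (A : set Z).
Proof.
move=> oA.
pose box (k : 'rV[rat]_n * rat * nat) : set Z :=
  [set x : 'rV[R]_n |
    forall i, ball (ratr (k.1.1 ord0 i) : R) k.2.+1%:R^-1 (x ord0 i)] `*`
  (ball (ratr k.1.2 : R) k.2.+1%:R^-1 : set (measurableTypeR R)).
have mbox k : measurable (box k).
  apply: measurableX; last exact: measurable_ball.
  by apply: (@measurable_rV_box _ _
    (fun i => ball (ratr (k.1.1 ord0 i) : R) k.2.+1%:R^-1)) => i;
      exact: measurable_ball.
rewrite (_ : A = \bigcup_(k in setT)
  (if `[< box k `<=` A >] then box k else set0)).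
  apply: countable_bigcupT_measurable => [|k]; first exact: countableP.
  by case: ifPn.
apply/seteqP; split=> [[x t] Axt|z [k _]]; last first.
  by case: ifPn => // /asboolP; exact.
have /nbhs_ballP[e /= e0 eA] : nbhs ((x, t) : 'rV[R]_n * R) A.
  exact: open_nbhs_nbhs.
(* A box of radius below e / 2 that contains the point lies in the ball of radius e around it. *)
have [k ke] : exists k : nat, k.+1%:R^-1 < e / 2.
  have /ltr_add_invr[k] : 0 < e / 2 by rewrite divr_gt0.
  by rewrite add0r => ke; exists k.
have k0 : 0 < k.+1%:R^-1 :> R by rewrite invr_gt0.
have ex (s : R) : exists q : rat, ball (ratr q : R) k.+1%:R^-1 s.
  have /rat_in_itvoo[q] : s - k.+1%:R^-1 < s + k.+1%:R^-1
    by rewrite ltrD2l gtrN.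
  rewrite in_itv/= => /andP[q1 q2]; exists q.
  by rewrite -ball_normE/= ltr_distl q1 q2.
have [q hq] := choice (fun i => ex (x ord0 i)).
have [q' hq'] := ex t.
exists (\row_i q i, q', k) => //; rewrite asboolT => /=.
  by split=> //= i; rewrite mxE.
move=> [y s] [/= hy hs]; apply: eA; have ke' : k.+1%:R^-1 + k.+1%:R^-1 <= e.
  by rewrite [e]splitr lerD// ltW.
split=> /=.
  split=> // i0 i; rewrite (ord1 i0); apply: le_ball ke' _ _.
  by apply: ball_triangle (hy i); rewrite /= mxE; exact/ball_sym.
by apply: le_ball ke' _ _; apply: ball_triangle hs; exact/ball_sym.
Qed.

Lemma measurable_fun_continuous (f : 'rV[R]_n * R -> R) : continuous f ->
  measurable_fun [set: Z] f.
Proof.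
move=> cf; apply: (measurability _ (RGenOpens.measurableE R)).
move=> _ [_ [a [b ->] <-]]; rewrite setTI; apply: measurable_open.
by move: cf => /continuousP; apply; exact: interval_open.
Qed.

Lemma measurable_quartic : measurable_fun [set: Z] (@quartic R n).
Proof. exact: (measurable_fun_continuous (@continuous_quartic R n)). Qed.

Lemma measurable_grushin_norm : measurable_fun [set: Z] (@grushin_norm R n).
Proof.
rewrite (_ : @grushin_norm R n = (fun s => s `^ 4^-1) \o @quartic R n).
  apply: measurableT_comp; last exact: measurable_quartic.
  exact: measurable_powR.
by apply/funext => z; exact: grushin_normE.
Qed.

Lemma measurable_coord_x i : measurable_fun [set: Z] (@coord_x R n i).
Proof. exact: (measurable_fun_continuous (@continuous_coord_x R n i)). Qed.

Lemma measurable_coord_t : measurable_fun [set: Z] (@coord_t R n).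
Proof. exact: (measurable_fun_continuous (@continuous_coord_t R n)). Qed.

Lemma measurable_inv_norm :
  measurable_fun [set: Z] (fun z => (@grushin_norm R n z)^-1).
Proof.
rewrite (_ : (fun z => _) = (fun s => s `^ (-1)) \o @grushin_norm R n).
  by apply: measurableT_comp measurable_grushin_norm; exact: measurable_powR.
by apply/funext => z /=; rewrite powR_inv1// grushin_norm_ge0.
Qed.

Lemma measurable_weight : measurable_fun [set: Z] (@weight R n).
Proof.
rewrite (_ : @weight R n = fun z => (\sum_(i < n) coord_x i z ^+ 2)
    * ((grushin_norm z)^-1 ^+ 2)).
  apply: measurable_funM; last
    by apply: measurable_funX; exact: measurable_inv_norm.
  by apply: measurable_sum => i; apply: measurable_funX;
    exact: measurable_coord_x.
by apply/funext => z; rewrite /weight sqr_enorm exprVn.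
Qed.

Lemma measurable_dilation d (T : measurableType d) (l : T -> R) (f : T -> Z) :
  measurable_fun setT l -> measurable_fun setT f ->
  measurable_fun setT (fun x => dilation (l x) (f x) : Z).
Proof.
move=> ml mf; apply/measurable_fun_pairP; split.
  apply: measurable_fun_rV => i.
  rewrite (_ : _ \o _ = fun x => l x * coord_x i (f x)); last first.
    by apply/funext => x; rewrite /rV_coord/= mxE.
  apply: measurable_funM => //;
    apply: (measurableT_comp (measurable_coord_x i)) => //.
apply: measurable_funM; first exact: measurable_funX.
exact: (measurableT_comp measurable_coord_t).
Qed.

End grushin_measurability.

(** * Averaging over dilation orbits *)

Section ray_average.
Local Open Scope ereal_scope.
Context (R : realType) (n : nat).
Local Notation Z := ('rV[R]_n * measurableTypeR R)%type.
Implicit Types (z y p q : Z).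

Definition sigma_finite_volume : {sigma_finite_measure set Z -> \bar R} :=
  sigma_finite_product (rV_lebesgue R n) lebesgue_measure.

Local Notation mu := sigma_finite_volume.
Local Notation rho := (@grushin_norm R n).

Lemma grushin_volumeE : grushin_volume R n = mu.
Proof. by []. Qed.

(** The exponent is Q = n + 2: a factor l from each of the n coordinates of x, and l^2 from t. *)
Lemma scales_by_dilation (l : R) : (0 < l)%R ->
  scales_by mu (fun z => dilation l z : Z) (l^-1 ^+ n.+2).
Proof.
move=> l0; have l20 : (0 < l ^+ 2)%R by rewrite exprn_gt0.
have := scales_by_prod (scales_by_rV_lebesgue n l0) (scales_by_lebesgue l20).
by rewrite -exprVn -exprD addn2.
Qed.

Lemma integral_dilation (l : R) (f : Z -> \bar R) : (0 < l)%R ->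
  measurable_fun setT f -> (forall z, 0 <= f z) ->
  \int[mu]_z f (dilation l z) = (l^-1 ^+ n.+2)%:E * \int[mu]_z f z.
Proof. by move=> l0 mf f0; have [_ _] := scales_by_dilation l0; exact. Qed.

Lemma integral_dilationV (l : R) (f : Z -> \bar R) : (0 < l)%R ->
  measurable_fun setT f -> (forall z, 0 <= f z) ->
  \int[mu]_z f z = (l ^+ n.+2)%:E * \int[mu]_z f (dilation l z).
Proof.
move=> l0 mf f0; rewrite integral_dilation// muleA -EFinM -exprMn divff
  ?gt_eqF//.
by rewrite expr1n mul1e.
Qed.

Context (H : Z -> \bar R) (mH : measurable_fun setT H).
Context (H_ge0 : forall z, 0 <= H z) (H0 : H 0%R = 0).
Context (phi : R -> R) (mphi : measurable_fun setT phi).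
Context (phi_ge0 : forall s, (0 <= phi s)%R).

Let mw : measurable_fun setT (fun z => (@weight R n z)%:E).
Proof. apply/measurable_EFinP; exact: measurable_weight. Qed.

Let mrho : measurable_fun [set: Z] rho.
Proof. exact: measurable_grushin_norm. Qed.

Let mV : measurable_fun [set: Z] (fun z => (rho z)^-1)%R.
Proof. exact: measurable_inv_norm. Qed.

Let F1 (x : Z * Z) : \bar R :=
  (phi (rho x.1))%:E * (H (dilation (rho x.2) x.1) * (weight x.2)%:E).

Let F2 (x : Z * Z) : \bar R :=
  ((rho x.1)^-1 ^+ n.+2)%:E *
    ((phi (rho x.2 / rho x.1))%:E * (H x.2 * (weight x.1)%:E)).

Let F1_ge0 x : 0 <= F1 x.
Proof. by rewrite mule_ge0 ?lee_fin// mule_ge0// lee_fin weight_ge0. Qed.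

Let V_ge0 z : (0 <= (rho z)^-1 ^+ n.+2)%R.
Proof. by rewrite exprn_ge0// invr_ge0 grushin_norm_ge0. Qed.

Let F2_ge0 x : 0 <= F2 x.
Proof.
rewrite mule_ge0 ?lee_fin// mule_ge0 ?lee_fin//.
by rewrite mule_ge0// lee_fin weight_ge0.
Qed.

Let mF1 : measurable_fun setT F1.
Proof.
apply: emeasurable_funM.
  apply/measurable_EFinP/(measurableT_comp mphi).
  exact: (measurableT_comp mrho measurable_fst).
apply: emeasurable_funM.
  apply: (measurableT_comp mH); apply: measurable_dilation => //.
  exact: (measurableT_comp mrho measurable_snd).
exact: (measurableT_comp mw measurable_snd).
Qed.

Let mF2 : measurable_fun setT F2.
Proof.
apply: emeasurable_funM.
  apply/measurable_EFinP/measurable_funX.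
  exact: (measurableT_comp mV measurable_fst).
apply: emeasurable_funM.
  apply/measurable_EFinP/(measurableT_comp mphi)/measurable_funM.
    exact: (measurableT_comp mrho measurable_snd).
  exact: (measurableT_comp mV measurable_fst).
apply: emeasurable_funM.
  exact: (measurableT_comp mH measurable_snd).
exact: (measurableT_comp mw measurable_fst).
Qed.

Lemma measurable_on_ray d (T : measurableType d) (f g : T -> Z) :
  measurable_fun setT f -> measurable_fun setT g ->
  measurable_fun setT (fun x => on_ray (f x) (g x) : Z).
Proof.
move=> mf mg; apply: measurable_dilation => //; apply: measurable_funM.
  exact: (measurableT_comp mrho mg).
exact: (measurableT_comp mV mf).
Qed.

(** Three dilations with an exchange of integrals between consecutive ones. Replacing y by
    delta_(rho p) y turns [on_ray p y] into delta_(rho y) p, with a Jacobian that cancels rho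
    (p)^(-Q) and leaves [F1]. Setting q = delta_(rho y) p frees the argument of [H] and leaves [F2].
    Replacing y by delta_(rho q) y frees the remaining factor from q, the powers of rho (q)
    cancelling. *)
Lemma integral_ray_average :
  \int[mu]_p ((phi (rho p) * (rho p)^-1 ^+ n.+2)%:E *
     \int[mu]_y (H (on_ray p y) * (weight y)%:E)) =
  (\int[mu]_y ((weight y * (rho y)^-1 ^+ n.+2 * phi (rho y)^-1)%:E)) *
     \int[mu]_z H z.
Proof.
transitivity (\int[mu]_p \int[mu]_y F1 (p, y)).
  apply: eq_integral => p _; rewrite /F1/= ge0_integralZl//; last 3 first.
  - apply: emeasurable_funM => //; apply: (measurableT_comp mH).
    by apply: measurable_dilation => //; exact: measurable_cst.
  - by move=> y _; rewrite mule_ge0// lee_fin weight_ge0.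
  - by rewrite lee_fin.
  rewrite EFinM -muleA; congr (_ * _).
  (* At p = 0 both sides vanish: one because the inverse of 0 is 0, the other because [H] is 0 at
     the origin. *)
  have [->|p0] := @eqVneq ('rV[R]_n * R)%type p 0%R.
    rewrite grushin_norm0 invr0 expr0n mul0e integral0_eq// => y _.
    by rewrite /dilation scaler0 mulr0 H0 mul0e.
  have l0 : (0 < rho p)%R by rewrite grushin_norm_gt0.
  have E := @integral_dilation (rho p)
    (fun y => H (on_ray p y) * (weight y)%:E) l0.
  apply: etrans; first (apply: esym; apply: E).
  - apply: emeasurable_funM => //; apply: (measurableT_comp mH).
    by apply: measurable_on_ray => //; exact: measurable_cst.
  - by move=> y; rewrite mule_ge0// lee_fin weight_ge0.
  apply: eq_integral => y _; rewrite weight_dilation//; congr (H _ * _).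
  by rewrite /on_ray grushin_norm_dilation ?ltW// mulrAC divff ?mul1r// gt_eqF.
rewrite (fubini_tonelli F1)//.
transitivity (\int[mu]_y \int[mu]_q F2 (y, q)).
  apply: eq_integral => y _; rewrite /F1 /F2/=.
  have [->|y0] := @eqVneq ('rV[R]_n * R)%type y 0%R.
    by rewrite !integral0_eq// => z _; rewrite weight0 !mule0.
  have l0 : (0 < rho y)%R by rewrite grushin_norm_gt0.
  have mG : measurable_fun setT
      (fun q => (phi (rho q / rho y))%:E * (H q * (weight y)%:E)).
    apply: emeasurable_funM.
      apply/measurable_EFinP/(measurableT_comp mphi).
      by apply: measurable_funM; [exact: mrho|exact: measurable_cst].
    by apply: emeasurable_funM => //; exact: measurable_cst.
  have G0 q : 0 <= (phi (rho q / rho y))%:E * (H q * (weight y)%:E).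
    by rewrite mule_ge0 ?lee_fin// mule_ge0// lee_fin weight_ge0.
  rewrite ge0_integralZl ?lee_fin//.
  apply: etrans; last exact: (integral_dilation l0 mG G0).
  apply: eq_integral => q _; rewrite grushin_norm_dilation ?ltW//.
  by rewrite mulrAC divff ?mul1r// gt_eqF.
have c0 y : 0 <= (weight y * (rho y)^-1 ^+ n.+2 * phi (rho y)^-1)%:E.
  by rewrite lee_fin mulr_ge0// mulr_ge0// weight_ge0.
rewrite (fubini_tonelli F2)// -ge0_integralZl//; last exact: integral_ge0.
apply: eq_integral => q _.
have [->|q0] := @eqVneq ('rV[R]_n * R)%type q 0%R.
  by rewrite H0 mule0 integral0_eq// => y _; rewrite /F2/= H0 mul0e !mule0.
have s0 : (0 < rho q)%R by rewrite grushin_norm_gt0.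
have mc : measurable_fun setT
    (fun y => (weight y * (rho y)^-1 ^+ n.+2 * phi (rho y)^-1)%:E).
  apply/measurable_EFinP/measurable_funM;
    last exact: (measurableT_comp mphi mV).
  by apply: measurable_funM; [exact: measurable_weight|exact: measurable_funX].
have mFq : measurable_fun setT (fun y => F2 (y, q))
  by exact: measurable_fun_pair1.
rewrite (integral_dilationV s0 mFq) => [|y]; last exact: F2_ge0.
transitivity ((rho q ^+ n.+2)%:E * \int[mu]_y
   (((rho q)^-1 ^+ n.+2)%:E * ((weight y * (rho y)^-1 ^+ n.+2
     * phi (rho y)^-1)%:E * H q))).
  congr (_ * _); apply: eq_integral => y _.
  rewrite /F2/= grushin_norm_dilation ?ltW// weight_dilation//.
  have -> : (rho q / (rho q * rho y) = (rho y)^-1)%R.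
    by rewrite invfM mulrA divff ?mul1r// gt_eqF.
  rewrite invfM exprMn.
  rewrite [H q * _]muleC !muleA -!EFinM; congr (_%:E * _); ring.
rewrite ge0_integralZl ?lee_fin//; last 2 first.
- by apply: emeasurable_funM => //; exact: measurable_cst.
- by move=> y _; rewrite mule_ge0.
rewrite ge0_integralZr//.
by rewrite muleA -EFinM -exprMn divff ?gt_eqF// expr1n mul1e.
Qed.

End ray_average.

(** * Integrals of nonnegative functions that may fail to be measurable *)

Section nonmeasurable_integral.
Local Open Scope ereal_scope.
Context d (T : measurableType d) (R : realType).
Context (mu : {measure set T -> \bar R}).
Import HBNNSimple.

(* [ge0_ae_eq_integral] without measurability: for a nonnegative function the
   integral is the supremum of the integrals of the simple functions below it,
   and these can be made to vanish on a measurable null set. *)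
Lemma ge0_le_integral_off_null (N : set T) (f g : T -> \bar R) :
  measurable N -> mu N = 0 ->
  (forall x, 0 <= f x) -> (forall x, 0 <= g x) ->
  (forall x, ~ N x -> f x <= g x) -> \int[mu]_x f x <= \int[mu]_x g x.
Proof.
move=> mN N0 f0 g0 fg; rewrite !ge0_integralTE//.
apply: ge_ereal_sup => _ [h hf <-]; apply: le_ereal_sup_tmp.
have mNC : measurable (~` N) by exact: measurableC.
have [h' hE] : exists h' : {nnsfun T >-> R},
    forall x, h' x = (h x * \1_(~` N) x)%R.
  by exists (proj_nnsfun h mNC).
exists (sintegral mu h').
  exists h' => //= x; rewrite hE indicE.
  have [/set_mem Nx|_] := boolP (x \in ~` N); last by rewrite mulr0.
  by rewrite mulr1 (le_trans (hf x))// fg.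
rewrite -!integralT_nnsfun (ge0_ae_eq_integral (g := EFin \o h'))//.
- exact/measurable_EFinP.
- exact/measurable_EFinP.
- by move=> x _; rewrite lee_fin.
- by move=> x _; rewrite /= lee_fin.
exists N; split=> // x /= /not_implyP[_]; apply: contra_notP => Nx.
by rewrite hE indicE mem_set// mulr1.
Qed.

Lemma ge0_eq_integral_off_null (N : set T) (f g : T -> \bar R) :
  measurable N -> mu N = 0 ->
  (forall x, 0 <= f x) -> (forall x, 0 <= g x) ->
  (forall x, ~ N x -> f x = g x) -> \int[mu]_x f x = \int[mu]_x g x.
Proof.
move=> mN N0 f0 g0 fg; apply/eqP; rewrite eq_le; apply/andP; split;
  by apply: (ge0_le_integral_off_null mN N0) => // x /fg ->.
Qed.

End nonmeasurable_integral.

(** * The normalising constant C of the average *)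

Section annulus.
Local Open Scope ereal_scope.
Context (R : realType) (n : nat).
Local Notation Z := ('rV[R]_n * measurableTypeR R)%type.
Local Notation mu := (sigma_finite_volume R n).
Local Notation rho := (@grushin_norm R n).

(* Large enough for 1 <= rho <= beta to hold on the cube ]1, 2[^(n+1). *)
Let beta : R := ((4 * n%:R) ^+ 2 + 16)%R.

(** In [annulus_mass] the cutoff is evaluated at 1 / rho, so this interval becomes 1 <= rho <= beta
    there. *)
Definition annulus_cutoff : R -> R := \1_(`[(beta^-1)%R, 1%R]%classic : set R).

Definition annulus_mass : \bar R :=
  \int[mu]_y (weight y * (rho y)^-1 ^+ n.+2 * annulus_cutoff (rho y)^-1)%:E.

Lemma measurable_annulus_cutoff : measurable_fun setT annulus_cutoff.
Proof. exact: measurable_indic. Qed.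

Lemma annulus_cutoff_ge0 s : (0 <= annulus_cutoff s)%R.
Proof. by rewrite /annulus_cutoff indicE. Qed.

Let beta_ge1 : (1 <= beta)%R.
Proof. by have := sqr_ge0 (4 * n%:R : R)%R; rewrite /beta; lra. Qed.

Let cutoffV (s : R) : (0 < s)%R -> (1 <= s <= beta)%R ->
  annulus_cutoff s^-1 = 1%R.
Proof.
move=> s0 /andP[s1 sb]; rewrite /annulus_cutoff indicE mem_set//= in_itv/=.
by rewrite invf_le1// s1 lef_pV2 ?posrE ?sb// (lt_le_trans ltr01).
Qed.

Let measurable_density : measurable_fun [set: Z]
  (fun y => (weight y * (rho y)^-1 ^+ n.+2 * annulus_cutoff (rho y)^-1)%:E).
Proof.
apply/measurable_EFinP/measurable_funM; last first.
  exact: (measurableT_comp measurable_annulus_cutoff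
    (@measurable_inv_norm R n)).
apply: measurable_funM; first exact: measurable_weight.
by apply: measurable_funX; exact: measurable_inv_norm.
Qed.

Let density_ge0 (y : Z) :
  0 <= (weight y * (rho y)^-1 ^+ n.+2 * annulus_cutoff (rho y)^-1)%:E.
Proof.
rewrite lee_fin mulr_ge0 ?annulus_cutoff_ge0// mulr_ge0 ?weight_ge0//.
by rewrite exprn_ge0// invr_ge0 grushin_norm_ge0.
Qed.

Let cube (I : set (measurableTypeR R)) : set Z :=
  [set x : 'rV[R]_n | forall i, I (x ord0 i)] `*` I.

Let measurable_cube I : measurable I -> measurable (cube I).
Proof.
by move=> mI; apply: measurableX => //;
  exact: (@measurable_rV_box _ _ (fun=> I)).
Qed.

Let mu_cube I : measurable I -> mu (cube I) = lebesgue_measure I ^+ n.+1.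
Proof.
move=> mI; rewrite -[LHS]/((rV_lebesgue R n \x lebesgue_measure) (cube I)).
rewrite product_measure1E//; last exact: (@measurable_rV_box _ _ (fun=> I)).
transitivity (lebesgue_measure I ^+ n * lebesgue_measure I); last
  by rewrite expeS muleC.
by congr (_ * _); exact: rV_lebesgue_cube.
Qed.

Lemma weight_le1 (z : Z) : (weight z <= 1)%R.
Proof.
have [->|z0] := @eqVneq ('rV[R]_n * R)%type z 0%R; first by rewrite weight0.
have g0 : (0 < rho z)%R by rewrite grushin_norm_gt0.
rewrite /weight ler_pdivrMr ?exprn_gt0// mul1r -(@ler_pXn2r _ 2) ?nnegrE
  ?sqr_ge0//.
by rewrite -!exprM grushin_norm_X4 quarticE lerDl mulr_ge0 ?sqr_ge0.
Qed.

Lemma annulus_mass_lty : annulus_mass < +oo.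
Proof.
(* The bound of [quartic_le_coord_bound] for rho^4 <= beta^4: the cube of half-side [L] contains the
   annulus, on which the density is at most 1. *)
pose L : R := (1 + `|beta ^+ 4|)%R;
  pose I : set (measurableTypeR R) := `[(- L)%R, L]%classic.
have mI : measurable I by exact: measurable_itv.
apply: (@le_lt_trans _ _ (\int[mu]_y (\1_(cube I) y)%:E)); last first.
  rewrite integral_indic//; last exact: measurable_cube.
  have fI : lebesgue_measure I \is a fin_num.
    by rewrite lebesgue_measure_itv/=; case: ifPn.
  by rewrite setIT [X in X < _](mu_cube mI) ltey_eq fin_numX.
apply: ge0_le_integral => //.
  by apply/measurable_EFinP; apply: measurable_indic; exact: measurable_cube.
move=> y _; rewrite lee_fin.
have V0 : (0 <= (rho y)^-1)%R by rewrite invr_ge0 grushin_norm_ge0.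
have [yI|yI] := boolP ((rho y)^-1%R \in
    (`[(beta^-1)%R, 1%R]%classic : set R)); last first.
  by rewrite /annulus_cutoff indicE (negbTE yI) mulr0 indicE.
have := set_mem yI; rewrite /= in_itv/= => /andP[Vb V1].
have b0 : (0 < beta)%R by rewrite (lt_le_trans ltr01).
have r0 : (0 < rho y)%R by rewrite -invr_gt0 (lt_le_trans _ Vb)// invr_gt0.
have rb : (rho y <= beta)%R by rewrite -lef_pV2 ?posrE.
have /quartic_le_coord_bound[yx yt] : (quartic y <= beta ^+ 4)%R.
  by rewrite -grushin_norm_X4 ler_pXn2r// nnegrE ltW.
have -> : \1_(cube I) y = 1%R :> R.
  by rewrite indicE mem_set//; split=> /= [i|]; rewrite in_itv/=.
rewrite /annulus_cutoff indicE yI mulr1 mulr_ile1 ?weight_ge0 ?weight_le1//.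
  exact: exprn_ge0.
exact: exprn_ile1.
Qed.

Lemma annulus_mass_gt0 : (0 < n)%N -> 0 < annulus_mass.
Proof.
move=> n0; pose I : set (measurableTypeR R) := `]1%R, 2%R[%classic.
have mI : measurable I by exact: measurable_itv.
have b0 : (0 < beta)%R by rewrite (lt_le_trans ltr01).
(* A lower bound for the density on the cube, which has measure 1: |x| >= 1 and rho <= beta give w
   >= beta^(-2) and rho^(-Q) >= beta^(-Q). *)
pose c : R := (beta ^- 2 * beta^-1 ^+ n.+2)%R.
have c0 : (0 < c)%R by rewrite mulr_gt0 ?exprn_gt0 ?invr_gt0// exprn_gt0.
apply: (@lt_le_trans _ _ (\int[mu]_(y in cube I) c%:E)).
  rewrite integral_cst; last exact: measurable_cube.
  have I1 : lebesgue_measure I = 1%:E.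
    by rewrite lebesgue_measure_itv/= lte_fin ltr1n/= -EFinB; congr _%:E; lra.
  by rewrite [X in _ < _ * X](mu_cube mI) I1 -EFin_expe expr1n mule1 lte_fin.
apply: (@le_trans _ _ (\int[mu]_(y in cube I)
  (weight y * (rho y)^-1 ^+ n.+2 * annulus_cutoff (rho y)^-1)%:E)); last first.
  by apply: ge0_subset_integral => //; exact: measurable_cube.
apply: ge0_le_integral => //.
- exact: measurable_cube.
- by move=> y _; rewrite lee_fin ltW.
- exact: measurable_funS measurable_density.
move=> y [/= yI yt]; rewrite lee_fin.
have x2 i : (1 <= y.1 ord0 i ^+ 2 <= 4)%R.
  by have := yI i; rewrite /I/= in_itv/= => /andP[? ?]; nra.
have t2 : (1 <= y.2 ^+ 2 <= 4)%R.
  by move: yt; rewrite /I/= in_itv/= => /andP[? ?]; nra.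
have e1 : (1 <= enorm y.1 ^+ 2)%R.
  rewrite sqr_enorm (bigD1 (Ordinal n0))//=.
  have /andP[h _] := x2 (Ordinal n0); rewrite (le_trans h)// lerDl.
  by apply: sumr_ge0 => j _; exact: sqr_ge0.
have e4 : (enorm y.1 ^+ 2 <= 4 * n%:R)%R.
  rewrite sqr_enorm (le_trans (_ : _ <= \sum_(i < n) 4)%R)//.
    by apply: ler_sum => i _; have /andP[] := x2 i.
  by rewrite sumr_const card_ord mulr_natr.
(* [beta] bounds even rho^4, since |x|^4 <= (4 n)^2 and 4 t^2 <= 16; the bound on rho follows
   because rho >= 1. *)
have r4 : (1 <= rho y ^+ 4 <= beta)%R.
  rewrite grushin_norm_X4 quarticE -[4%N]/(2 * 2)%N exprM /beta.
  have : (1 <= (enorm y.1 ^+ 2) ^+ 2 <= (4 * n%:R) ^+ 2)%R.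
    by rewrite exprn_ege1//= ler_pXn2r ?nnegrE ?sqr_ge0// mulr_ge0.
  by move: t2 => /andP[? ?] /andP[? ?]; apply/andP; split; lra.
have r0 : (0 <= rho y)%R by exact: grushin_norm_ge0.
have /andP[r1 rb] : (1 <= rho y <= beta)%R.
  move: r4 => /andP[r41 r4b].
  have r1 : (1 <= rho y)%R by rewrite -(@ler_pXn2r _ 4) ?nnegrE// expr1n.
  by rewrite r1 (le_trans _ r4b)//= -[leLHS]expr1 ler_weXn2l.
have rp : (0 < rho y)%R by rewrite (lt_le_trans ltr01).
rewrite cutoffV// ?r1//= mulr1 /c ler_pM//.
- by rewrite invr_ge0 sqr_ge0.
- by rewrite exprn_ge0// invr_ge0 ltW.
- rewrite /weight (le_trans (_ : _ <= (rho y ^+ 2)^-1)%R)//.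
    by rewrite lef_pV2 ?posrE ?exprn_gt0// ler_pXn2r ?nnegrE// ltW.
  by rewrite ler_peMl// invr_ge0 sqr_ge0.
rewrite ler_pXn2r ?nnegrE ?invr_ge0 ?(ltW b0)//.
by rewrite lef_pV2 ?posrE.
Qed.

End annulus.

(** * Reduction to radial functions *)

Lemma measurable_ray_integral (R : realType) (n : nat)
    (H : 'rV[R]_n * measurableTypeR R -> \bar R) :
  measurable_fun setT H -> (forall z, 0 <= H z)%E ->
  measurable_fun setT (fun p : 'rV[R]_n * measurableTypeR R =>
    \int[sigma_finite_volume R n]_y (H (on_ray p y) * (weight y)%:E))%E.
Proof.
move=> mH H0.
apply: (@measurable_fun_fubini_tonelli_F _ _ _ _ _ (sigma_finite_volume R n)
  (fun x => H (on_ray x.1 x.2) * (weight x.2)%:E)%E) => [|x]; last first.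
  by rewrite mule_ge0// lee_fin weight_ge0.
apply: emeasurable_funM.
  apply: (measurableT_comp mH); apply: measurable_on_ray.
    exact: measurable_fst.
  exact: measurable_snd.
apply/measurable_EFinP; apply: (measurableT_comp (@measurable_weight R n)).
exact: measurable_snd.
Qed.

Section radial_reduction.
Local Open Scope ereal_scope.
Context (R : realType) (n : nat) (n_gt0 : (0 < n)%N).
Local Notation Z := ('rV[R]_n * measurableTypeR R)%type.
Local Notation mu := (sigma_finite_volume R n).
Local Notation rho := (@grushin_norm R n).
Context (r : \bar R) (W : R -> R) (u : 'rV[R]_n * R -> R).
Context (tu : test_function (grushin_ball r `\ 0%R) u).
Local Notation B := (grushin_ball r : set Z).

Let du z : differentiable u z.
Proof. by have [su _ _] := tu; have [d _] := su 1%N; exact: d. Qed.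

Let continuous_derive v : continuous ('D_v u).
Proof. by have [su _ _] := tu; have [_ h] := su 1%N; exact: h. Qed.

Let u0 : u 0%R = 0%R.
Proof. by have [] := test_function_eq0 tu (z := 0%R) (fun h => h.2 erefl). Qed.

Lemma measurable_grushin_ball : measurable B.
Proof.
rewrite (_ : B = (fun z => (rho z)%:E) @^-1` `]-oo, r[%classic).
  rewrite -[X in measurable X]setTI.
  have mr : measurable_fun setT (fun z : Z => (rho z)%:E).
    by apply/measurable_EFinP; exact: measurable_grushin_norm.
  by apply: mr => //; exact: emeasurable_itv.
by apply/seteqP; split=> z; rewrite /grushin_ball/= in_itv/=.
Qed.

Let mB := measurable_grushin_ball.

Let measurable_derive v : measurable_fun [set: Z] ('D_v u).
Proof. exact: (measurable_fun_continuous (@continuous_derive v)). Qed.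

Let measurable_radial_derivative :
  measurable_fun [set: Z] (radial_derivative u).
Proof.
rewrite (_ : radial_derivative u = fun z : Z =>
  ((\sum_(i < n) coord_x i z * 'D_(basis_x R i) u z
     + 2 * coord_t z * 'D_(basis_t R n) u z) * (rho z)^-1)%R); last first.
  apply/funext => z; rewrite /radial_derivative derive_coordE//.
  by congr ((_ + _) / _)%R; apply: eq_bigr => i _; rewrite mxE.
apply: measurable_funM; last exact: measurable_inv_norm.
apply: measurable_funD.
  apply: measurable_sum => i; apply: measurable_funM => //.
  exact: measurable_coord_x.
apply: measurable_funM => //; apply: measurable_funM;
  first exact: measurable_cst.
exact: measurable_coord_t.
Qed.

Let measurable_sqnorm_grad :
  measurable_fun [set: Z] (fun z => sqnorm (grushin_grad u z)).
Proof.
rewrite (_ : (fun z => _) = fun z : Z =>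
  (\sum_(i < n) 'D_(basis_x R i) u z ^+ 2
   + (\sum_(i < n) coord_x i z ^+ 2) * 'D_(basis_t R n) u z ^+ 2)%R);
     last first.
  apply/funext => z; rewrite /sqnorm/= exprMn !sqr_enorm; congr (_ + _)%R.
  by apply: eq_bigr => i _; rewrite mxE.
apply: measurable_funD.
  by apply: measurable_sum => i; apply: measurable_funX.
apply: measurable_funM; last exact: measurable_funX.
by apply: measurable_sum => i; apply: measurable_funX;
  exact: measurable_coord_x.
Qed.

Let radial_energy : Z -> \bar R :=
  (fun z => (radial_derivative u z ^+ 2 * weight z)%:E) \_ B.

Let radial_energy_ge0 z : 0 <= radial_energy z.
Proof.
apply: erestrict_ge0 => x _.
by rewrite lee_fin mulr_ge0 ?sqr_ge0 ?weight_ge0.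
Qed.

Let measurable_radial_energy : measurable_fun setT radial_energy.
Proof.
apply/(measurable_restrictT _ _).1; first exact: mB.
apply: measurable_funTS; apply/measurable_EFinP/measurable_funM.
  exact: measurable_funX.
exact: measurable_weight.
Qed.

Lemma radial_energy_le : \int[mu]_z radial_energy z <= energy r u.
Proof.
rewrite -integral_mkcond; apply: ge0_le_integral => //.
- by move=> z _; rewrite lee_fin mulr_ge0 ?sqr_ge0 ?weight_ge0.
- apply: measurable_funTS; apply/measurable_EFinP/measurable_funM.
    exact: measurable_funX.
  exact: measurable_weight.
- by apply: measurable_funTS; apply/measurable_EFinP.
- by move=> z _; rewrite lee_fin radial_derivative_le.
Qed.

Let measurable_cutoff : measurable_fun setT
  (fun p : Z => (annulus_cutoff n (rho p) * (rho p)^-1 ^+ n.+2)%:E).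
Proof.
apply/measurable_EFinP; apply: measurable_funM.
  exact: (measurableT_comp (@measurable_annulus_cutoff R n)
    (@measurable_grushin_norm R n)).
by apply: measurable_funX; exact: measurable_inv_norm.
Qed.

Let cutoff_ge0 (p : Z) : (0 <= annulus_cutoff n (rho p) * (rho p)^-1 ^+ n.+2)%R.
Proof.
by rewrite mulr_ge0 ?annulus_cutoff_ge0// exprn_ge0// invr_ge0 grushin_norm_ge0.
Qed.

Let ball_on_ray p y : p != 0%R -> B (on_ray p y) = B y.
Proof. by move=> p0; rewrite /grushin_ball/= grushin_norm_on_ray. Qed.

(** The squared gradient of u_p at y is the squared radial derivative of u at [on_ray p y] times w
    (y), while [radial_energy] has the weight w (p) at that point; exchanging the weights costs the
    factor in front. *)
Lemma energy_along_ray p : p != 0%R -> (0 < weight p)%R ->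
  energy r (along_ray u p) = (weight p)^-1%:E *
    \int[mu]_y (radial_energy (on_ray p y) * (weight y)%:E).
Proof.
move=> p0 wp; rewrite -ge0_integralZl//; last 3 first.
- apply: emeasurable_funM.
    apply: (measurableT_comp measurable_radial_energy).
    by apply: measurable_on_ray => //; exact: measurable_cst.
  by apply/measurable_EFinP; exact: measurable_weight.
- by move=> y _; rewrite mule_ge0// lee_fin weight_ge0.
- by rewrite lee_fin invr_ge0 ltW.
rewrite /energy grushin_volumeE [LHS]integral_mkcond; apply: eq_integral => y _.
rewrite /radial_energy !patchE.
have -> : (on_ray p y \in B) = (y \in B).
  by apply/idP/idP => /set_mem h; apply/mem_set; move: h; rewrite ball_on_ray.
case: ifPn => _; last by rewrite mul0e mule0.
have [->|y0] := @eqVneq ('rV[R]_n * R)%type y 0%R.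
  have [_ ->] := test_function_eq0 (test_function_along_ray p0 tu)
    (z := 0%R) (fun h => h.2 erefl).
  by rewrite weight0 mule0 mule0.
rewrite sqnorm_grad_along_ray// weight_on_ray// -!EFinM; congr _%:E.
by field; rewrite gt_eqF.
Qed.

Context (g : Z -> \bar R) (mg : measurable_fun B g).
Context (N : set Z) (mN : measurable N) (N0 : mu N = 0).
Context (fg : forall z, ~ N z -> B z -> (potential_density W u z)%:E = g z).

(** [g] is a Borel version of the potential density of u, with an arbitrary value at the origin.
    Removing that point makes [g0] vanish there, as the averaging identity requires. *)
Let B0 : set Z := B `\` [set 0%R].

Let g0 : Z -> \bar R := g \_ B0.

Let measurable_set0 : measurable ([set 0%R] : set Z).
Proof.
rewrite (_ : [set 0%R] = ~` [set z | z != 0%R]).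
  by apply: measurableC; apply: measurable_open; exact: open_neq0.
by apply/seteqP; split=> z /=; [move=> ->; rewrite eqxx|move/negP/negPn/eqP].
Qed.

Let mB0 : measurable B0.
Proof. exact: measurableD. Qed.

Let mg0 : measurable_fun setT g0.
Proof.
apply/(measurable_restrictT _ _).1; first exact: mB0.
by apply: measurable_funS mg => // z [].
Qed.

Lemma potential_densityE z : z != 0%R ->
  potential_density W u z = (W (rho z) * `|u z| ^+ 2 * weight z)%R.
Proof. by move=> z0; rewrite /potential_density sqnorm_grad_grushin_norm. Qed.

(* [op] is the positive or the negative part. *)
Section part.
Context (op : \bar R -> \bar R).
Context (op0 : op 0 = 0) (op_ge0 : forall x, 0 <= op x).
Context (opM : forall (c : R) x, (0 <= c)%R -> op (c%:E * x) = c%:E * op x).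
Context (mop : measurable_fun setT op).

(** The potential density itself need not be Borel; it agrees with [g0] off [N], and at the origin
    both are 0 because u vanishes there. *)
Lemma integral_potential_part :
  \int[mu]_(z in B) op (potential_density W u z)%:E = \int[mu]_z op (g0 z).
Proof.
rewrite [LHS]integral_mkcond;
  apply: (ge0_eq_integral_off_null mN N0) => // [z|z Nz].
  exact: erestrict_ge0.
rewrite /g0 !patchE; have [->|z0] := @eqVneq ('rV[R]_n * R)%type z 0%R.
  rewrite [_ \in B0]memNset => [|[_]]//=.
  by case: ifPn => // _; rewrite /potential_density u0 normr0 expr0n mulr0
    mul0r.
case: ifPn => [/set_mem zB|zB].
  by rewrite mem_set ?fg//; split=> //=; exact/eqP.
by rewrite [_ \in B0]memNset// => -[/mem_set]; rewrite (negbTE zB).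
Qed.

(** [on_ray p] preserves rho, so W is evaluated at the same radius on both sides and only the
    weights are exchanged, as for the energy. The almost-everywhere hypothesis allows [g] to replace
    the density of u at [on_ray p y]; where w (y) = 0 both integrands vanish anyway. *)
Lemma integral_potential_part_along_ray p : p != 0%R -> (0 < weight p)%R ->
  {ae mu, forall y, N (on_ray p y) -> weight y = 0%R \/ y = 0%R} ->
  \int[mu]_(y in B) op (potential_density W (along_ray u p) y)%:E =
  (weight p)^-1%:E * \int[mu]_y (op (g0 (on_ray p y)) * (weight y)%:E).
Proof.
move=> p0 wp [M [mM M0 NM]]; rewrite -ge0_integralZl//; last 3 first.
- apply: emeasurable_funM; last
  by apply/measurable_EFinP; exact: measurable_weight.
  apply: (measurableT_comp mop); apply: (measurableT_comp mg0).
  by apply: measurable_on_ray => //; exact: measurable_cst.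
- by move=> y _; rewrite mule_ge0// lee_fin weight_ge0.
- by rewrite lee_fin invr_ge0 ltW.
have Vp : (0 <= (weight p)^-1)%R by rewrite invr_ge0 ltW.
rewrite [LHS]integral_mkcond;
  apply: (ge0_eq_integral_off_null mM M0) => [y|y|y My].
- exact: erestrict_ge0.
- by rewrite mule_ge0 ?lee_fin// mule_ge0// lee_fin weight_ge0.
have {}NM : N (on_ray p y) -> weight y = 0%R \/ y = 0%R.
  by apply: contrapT => h; apply: My; exact: NM.
rewrite patchE; have [->|y0] := @eqVneq ('rV[R]_n * R)%type y 0%R.
  rewrite weight0 !mule0; case: ifPn => // _.
  by rewrite /potential_density /along_ray on_ray0 u0 normr0 expr0n mulr0 mul0r.
have -> : (potential_density W (along_ray u p) y =
    W (rho y) * `|along_ray u p y| ^+ 2 * weight y)%R.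
  by rewrite /potential_density sqnorm_grad_grushin_norm.
have [w0|w0] := eqVneq (weight y) 0%R.
  by rewrite w0 mulr0 !mule0; case: ifPn.
have NyN : ~ N (on_ray p y).
  by move=> /NM[/eqP|/eqP]; rewrite ?(negbTE w0) ?(negbTE y0).
have ray0 : on_ray p y != 0%R.
  by rewrite -grushin_norm_gt0 grushin_norm_on_ray// grushin_norm_gt0.
rewrite /g0 patchE; case: ifPn => [/set_mem yB|yB]; last first.
  rewrite memNset ?op0 ?mul0e ?mule0// => -[].
  by rewrite ball_on_ray// => /mem_set; rewrite (negbTE yB).
rewrite mem_set; last by split; [rewrite ball_on_ray|exact/eqP].
rewrite -fg//; last by rewrite ball_on_ray.
rewrite potential_densityE// grushin_norm_on_ray// weight_on_ray//.
rewrite [op _ * _]muleC muleA -EFinM -opM; last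
  by apply: mulr_ge0 => //; exact: weight_ge0.
congr op; rewrite -!EFinM; congr _%:E.
rewrite /along_ray; move: (weight p) (weight y) wp => a b a0.
by field; rewrite gt_eqF.
Qed.

Lemma integral_ray_average_part :
  \int[mu]_p ((annulus_cutoff n (rho p) * (rho p)^-1 ^+ n.+2)%:E *
     \int[mu]_y (op (g0 (on_ray p y)) * (weight y)%:E)) =
  annulus_mass R n * \int[mu]_z op (g0 z).
Proof.
rewrite (@integral_ray_average _ _ (fun z => op (g0 z)))//.
- exact: (measurableT_comp mop).
- by rewrite /g0 patchE memNset// => -[_]; exact.
- exact: measurable_annulus_cutoff.
Qed.

End part.

(** The weight vanishes only on the axis x = 0, which is a null set because n > 0. *)
Lemma ae_weight_gt0 : {ae mu, forall p, (0 < weight p)%R}.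
Proof.
pose I : set (measurableTypeR R) := [set 0%R].
have mI : measurable I by exact: measurable_set1.
have mI' : measurable [set x : 'rV[R]_n | forall i, I (x ord0 i)].
  exact: (@measurable_rV_box _ _ (fun=> I)).
exists ([set x : 'rV[R]_n | forall i, I (x ord0 i)] `*` setT); split.
- exact: measurableX.
- rewrite -[LHS]/((rV_lebesgue R n \x lebesgue_measure) _) product_measure1E//.
  rewrite [X in X * _](rV_lebesgue_cube n mI) lebesgue_measure_set1.
  suff /eqP -> : (0 : \bar R) ^+ n == 0 by rewrite mul0e.
  by rewrite expe_eq0 n_gt0 eqxx.
move=> p /= wp; split=> //= i.
suff -> : p.1 = 0%R by rewrite mxE.
apply: enorm_eq0; apply/eqP; rewrite -[_ == _]negbK; apply/negP => e0;
  apply: wp.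
rewrite lt_neqAle weight_ge0 andbT eq_sym mulf_neq0
  ?expf_neq0// invr_eq0 expf_neq0//.
rewrite gt_eqF// grushin_norm_gt0; apply: contraNneq e0 => ->.
by rewrite /enorm big1 ?sqrtr0// => j _; rewrite mxE expr0n.
Qed.

(** The averaging identity for the indicator function of [N] without the origin has right-hand side
    C * 0. A nonnegative function with zero integral is 0 almost everywhere; this is used in p and
    then, for almost every p in the annulus, in y. *)
Lemma ae_on_ray_notin_null :
  {ae mu, forall p, annulus_cutoff n (rho p) * (rho p)^-1 ^+ n.+2 != 0 ->
  {ae mu, forall y, N (on_ray p y) -> weight y = 0 \/ y = 0}}%R.
Proof.
have mD : measurable (N `\` [set 0%R]) by exact: measurableD.
pose H (z : Z) : \bar R := (\1_(N `\` [set 0%R]) z)%:E.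
have mH : measurable_fun setT H
  by apply/measurable_EFinP; exact: measurable_indic.
have H_ge0 z : 0 <= H z by rewrite lee_fin.
have H00 : H 0%R = 0 by rewrite /H indicE memNset// => -[_]; exact.
have := integral_ray_average mH H_ge0 H00 (@measurable_annulus_cutoff R n)
  (@annulus_cutoff_ge0 R n).
rewrite integral_indic// setIT.
rewrite [X in _ = _ * X -> _](_ : _ = 0) ?mule0; last first.
  by apply: (subset_measure0 _ _ _ N0) => //; exact: subDsetl.
pose J p := \int[mu]_y (H (on_ray p y) * (weight y)%:E).
pose F p := (annulus_cutoff n (rho p) * (rho p)^-1 ^+ n.+2)%:E * J p.
have J0 p : 0 <= J p by apply: integral_ge0 => y _;
  rewrite mule_ge0// lee_fin weight_ge0.
move=> F0; have mJ : measurable_fun setT J by exact: measurable_ray_integral.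
have mF : measurable_fun setT F
  by apply: emeasurable_funM => //; exact: measurable_cutoff.
have : \int[mu]_p `|F p| = 0.
  rewrite -[RHS]F0; apply: eq_integral => p _;
    rewrite gee0_abs// mule_ge0// lee_fin.
  exact: cutoff_ge0.
move=> F1; have := (ae_eq_integral_abs mu measurableT mF).1 F1;
  apply: filterS => p /(_ I) Fp cp.
have {Fp}Jp : J p = 0.
  by move/eqP: Fp; rewrite mule_eq0 eqe (negbTE cp)/= => /eqP.
have mHp : measurable_fun setT (fun y => H (on_ray p y) * (weight y)%:E).
  apply: emeasurable_funM; last
    by apply/measurable_EFinP; exact: measurable_weight.
  by apply: (measurableT_comp mH); apply: measurable_on_ray => //;
    exact: measurable_cst.
have : \int[mu]_y `|H (on_ray p y) * (weight y)%:E| = 0.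
  rewrite -[RHS]Jp; apply: eq_integral => y _;
    rewrite gee0_abs// mule_ge0// lee_fin.
  exact: weight_ge0.
move=> G0; have := (ae_eq_integral_abs mu measurableT mHp).1 G0;
  apply: filterS => y /(_ I) Hy Ny.
have p0 : p != 0%R.
  apply: contraNneq cp => ->; rewrite grushin_norm0 invr0 expr0n/= mulr0.
  by [].
have [->|y0] := @eqVneq ('rV[R]_n * R)%type y 0%R; [by right|left].
move/eqP: Hy; rewrite mule_eq0 => /orP[|]; rewrite eqe; last by move/eqP.
rewrite indicE mem_set ?oner_eq0//; split=> //= /eqP.
by apply/negP; rewrite -grushin_norm_gt0 grushin_norm_on_ray// grushin_norm_gt0.
Qed.

Lemma radial_inequality_extends :
  (forall v : 'rV[R]_n * R -> R,
     test_function (grushin_ball r `\ 0%R) v -> radial v ->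
     potential_energy r W v <= energy r v) ->
  potential_energy r W u <= energy r u.
Proof.
move=> hrad.
pose pos (x : \bar R) := maxe x 0; pose neg (x : \bar R) := maxe (- x) 0.
have pos0 : pos 0 = 0 by rewrite /pos maxxx.
have neg0 : neg 0 = 0 by rewrite /neg oppe0 maxxx.
have pos_ge0 x : 0 <= pos x by rewrite /pos le_max lexx orbT.
have neg_ge0 x : 0 <= neg x by rewrite /neg le_max lexx orbT.
have posM (c : R) x : (0 <= c)%R -> pos (c%:E * x) = c%:E * pos x.
  by move=> c0; rewrite /pos maxe_pMr ?mule0// lee_fin.
have negM (c : R) x : (0 <= c)%R -> neg (c%:E * x) = c%:E * neg x.
  by move=> c0; rewrite /neg -muleN maxe_pMr ?mule0// lee_fin.
have mpos : measurable_fun setT pos.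
  by apply: measurable_maxe => //; exact: measurable_cst.
have mneg : measurable_fun setT neg.
  by apply: measurable_maxe; [exact: oppe_measurable|exact: measurable_cst].
(* This holds for every [f], measurable or not, the difference of two infinities being -oo. *)
have intE (f : Z -> \bar R) : \int[mu]_(z in B) f z =
    \int[mu]_(z in B) pos (f z) - \int[mu]_(z in B) neg (f z).
  rewrite integralE; congr (_ - _); apply: eq_integral => z _.
    by rewrite funeposE.
  by rewrite funenegE.
pose cm p := (annulus_cutoff n (rho p) * (rho p)^-1 ^+ n.+2)%:E.
pose A (op : \bar R -> \bar R) p :=
  \int[mu]_y (op (g0 (on_ray p y)) * (weight y)%:E).
pose E p := \int[mu]_y (radial_energy (on_ray p y) * (weight y)%:E).
have A0 op p : (forall x, 0 <= op x) -> 0 <= A op p.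
  by move=> op_ge0; apply: integral_ge0 => y _;
    rewrite mule_ge0// lee_fin weight_ge0.
have E0 p : 0 <= E p.
  by apply: integral_ge0 => y _; rewrite mule_ge0// lee_fin weight_ge0.
have cm0 p : 0 <= cm p by rewrite lee_fin; exact: cutoff_ge0.
(* The radial inequality for u_p multiplied by w (p), with the negative part moved to the right:
   only nonnegative terms remain, and they can be integrated over p even when infinite. *)
have ray_ineq : {ae mu, forall p, setT p ->
  cm p * A pos p <= cm p * (E p + A neg p)}.
  apply: (@filterS2 _ _ (ae_filter_ringOfSetsType mu) _ _
    _ _ ae_weight_gt0 ae_on_ray_notin_null) => p wp hp _.
  have [->|cp] := eqVneq (cm p) 0; first by rewrite !mul0e.
  have p0 : p != 0%R by apply: contraTneq wp => ->; rewrite weight0 ltxx.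
  rewrite lee_pmul2l//; last by rewrite lt_neqAle eq_sym cp cm0.
  have {}hp := hp cp.
  have := hrad _ (test_function_along_ray p0 tu) (radial_along_ray u p).
  rewrite /potential_energy grushin_volumeE intE.
  rewrite (integral_potential_part_along_ray pos0 pos_ge0 posM mpos p0 wp hp).
  rewrite (integral_potential_part_along_ray neg0 neg_ge0 negM mneg p0 wp hp).
  rewrite energy_along_ray// -/(A pos p) -/(A neg p) -/(E p).
  have V0 : 0 < (weight p)^-1%:E by rewrite lte_fin invr_gt0.
  (* If the negative part is infinite, the right-hand side is +oo and there is nothing to prove. *)
  have [->|An] := eqVneq (A neg p) +oo; first
    by rewrite addey ?leey// gt_eqF// (lt_le_trans _ (E0 p)).
  have fAn : A neg p \is a fin_num
    by rewrite ge0_fin_numE ?A0// lt_neqAle An leey.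
  by rewrite leeBlDr ?fin_numM// -muleDr ?fin_num_adde_defl// lee_pmul2l.
have measurableA (op : \bar R -> \bar R) : measurable_fun setT op ->
    (forall x, 0 <= op x) -> measurable_fun setT (A op).
  move=> mop op_ge0; apply: (@measurable_ray_integral _ _ (op \o g0)) => [|z].
    exact: measurableT_comp.
  exact: op_ge0.
have mE : measurable_fun setT E by exact: measurable_ray_integral.
have mcm : measurable_fun setT cm by exact: measurable_cutoff.
have L0 p : setT p -> 0 <= cm p * A pos p by move=> _; rewrite mule_ge0// A0.
have R0 p : setT p -> 0 <= cm p * (E p + A neg p).
  by move=> _; rewrite mule_ge0// adde_ge0// A0.
have mL : measurable_fun setT (fun p => cm p * A pos p).
  by apply: emeasurable_funM => //; exact: measurableA.
have mR : measurable_fun setT (fun p => cm p * (E p + A neg p)).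
  by apply: emeasurable_funM => //; apply: emeasurable_funD => //;
    exact: measurableA.
have := @ae_ge0_le_integral _ _ _ mu _ measurableT _ _ L0 mL R0 mR ray_ineq.
rewrite [X in _ <= X](_ : _ = \int[mu]_p (cm p * E p + cm p * A neg p));
  last first.
  by apply: eq_integral => p _; rewrite ge0_muleDr// A0.
rewrite ge0_integralD//; last 4 first.
- by move=> p _; rewrite mule_ge0.
- exact: emeasurable_funM.
- by move=> p _; rewrite mule_ge0// A0.
- by apply: emeasurable_funM => //; exact: measurableA.
have radial_energy0 : radial_energy 0%R = 0.
  by rewrite /radial_energy patchE weight0 mulr0; case: ifPn.
rewrite integral_ray_average_part// integral_ray_average_part//.
rewrite (integral_ray_average measurable_radial_energy radial_energy_ge0
  radial_energy0
  (@measurable_annulus_cutoff R n) (@annulus_cutoff_ge0 R n)).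
rewrite -/(annulus_mass R n) -ge0_muleDr; last 2 first.
- exact: integral_ge0.
- exact: integral_ge0.
have C0 := annulus_mass_gt0 R n_gt0.
rewrite lee_pmul2l//; last by rewrite ge0_fin_numE ?annulus_mass_lty// ltW.
move=> ineq; rewrite /potential_energy grushin_volumeE intE.
rewrite (integral_potential_part pos0 pos_ge0).
rewrite (integral_potential_part neg0 neg_ge0).
apply: le_trans radial_energy_le.
set x := \int[mu]_z neg (g0 z) in ineq *.
have x0 : 0 <= x by exact: integral_ge0.
(* If the negative part of the potential of u is infinite, the difference is -oo whatever the
   positive part is. *)
have [->|xy] := eqVneq x +oo; first by rewrite addeNy leNye.
by rewrite leeBlDr// ge0_fin_numE// lt_neqAle xy leey.
Qed.

End radial_reduction.

Theorem theorem6p1 (R : realType) (n : nat) (n_ge2 : (2 <= n)%N)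
    (r : \bar R) (r_gt0 : (0 < r)%E) (W : R -> R)
    (W_defined : forall u : 'rV[R]_n * R -> R,
      test_function (grushin_ball r `\ 0) u ->
      integral_defined (grushin_volume R n) (grushin_ball r)
        (fun z => (potential_density W u z)%:E)) :
  (forall u : 'rV[R]_n * R -> R,
      test_function (grushin_ball r `\ 0) u ->
      (energy r u >= potential_energy r W u)%E)
  <->
  (forall u : 'rV[R]_n * R -> R,
      test_function (grushin_ball r `\ 0) u -> radial u ->
      (energy r u >= potential_energy r W u)%E).
Proof.
split=> [h u tu _|h u tu]; first exact: h.
have [g [mg [N [mN N0 Nfg]] _]] := W_defined u tu.
apply: (radial_inequality_extends (ltnW n_ge2) tu mg mN N0) => // z Nz Bz.
by apply: contrapT => fg; apply: Nz; apply: Nfg => /(_ Bz).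
Qed.
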